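(* Let $T>0$, $f_0,f_T$ smooth, $K_1,K_2\ge1$ integers, and let $A$, $c_1$, $c_2$, $K$ and $t_1,\dots,t_K$ be as defined in the context. Put $$v^*(x)=\frac1K\sum_{i=1}^K t_i(x)+\frac{A_1}{2T},\qquad A_1=A-\int_{-T}^T\frac1K\sum_{i=1}^K t_i(x)\,dx,\qquad x\in[-T,T].$$ A minimum-input solution for the $L^2$ metric exists if and only if $v^*(T)=v^*(-T)+c_1$ and $(v^* )'(T)=(v^* )'(-T)+c_2$. If a minimum-input solution exists, then it is unique, and it is the solution whose input equals $v^*$ on $[-T,T]$.
   Context: TBVP: given smooth $f_0,f_T:\mathbb R\to\mathbb R$ and $T>0$, a solution is a function $u\in C^2([0,T]\times\mathbb R)$ with $u_{tt}-u_{xx}=0$, $u(0,x)=f_0(x)$, $u(T,x)=f_T(x)$. Its input is $v(x)=u_t(0,x)$; the set of all inputs is the input space. Metric: fix integers $K_1,K_2\ge 1$, put $K=K_1+K_2+1$; inputs are measured by the norm of $L^2[-(2K_1+1)T,(2K_2+1)T]$. A minimum-input solution (MS) is a solution whose input has minimal norm among all inputs. Constants: $A=2f_T(0)-f_0(T)-f_0(-T)$, $c_1=2f_T'(0)-f_0'(T)-f_0'(-T)$, $c_2=2f_T''(0)-f_0''(T)-f_0''(-T)$. Functions $t_i$ on $[-T,T]$, $i=1,\dots,K$: $t_1=0$; for $k=1,\dots,K_2$, $$t_{k+1}(x)=f_0'(x)+2\sum_{n=0}^{k-1}f_0'(x+(2k-2n)T)-2\sum_{n=0}^{k-1}f_T'(x+(2k-2n-1)T)-f_0'(x+2kT);$$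 for $k=1,\dots,K_1$, $$t_{k+K_2+1}(x)=f_0'(x)+2\sum_{n=0}^{k-1}f_T'(x+(2n+1-2k)T)-2\sum_{n=0}^{k-1}f_0'(x+2(n+1-k)T)-f_0'(x-2kT).$$ *)

(* Defs.v *)
From Stdlib Require Export Reals.
From Coquelicot Require Export Coquelicot.

Local Open Scope R_scope.

Definition smooth (f : R -> R) : Prop := forall (n : nat) (x : R), ex_derive_n f n x.

(** Functions on the closed strip [0,T] x R are represented by total functions
    [u : R -> R -> R]; only the values [u t x] with [0 <= t <= T] matter.
    [is_dt] is [is_derive] with the neighbourhood filter of [t] traced on [0,T],
    so the t-derivative is one-sided at [t = 0] and [t = T]. *)
Definition strip (T : R) (p : R * R) : Prop := 0 <= fst p <= T.

Definition is_dt (T : R) (u ut : R -> R -> R) : Prop :=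
  forall t x : R, 0 <= t <= T ->
    filterdiff (fun s : R => u s x)
      (within (fun s : R => 0 <= s <= T) (locally t))
      (fun h : R => scal h (ut t x)).

Definition is_dx (T : R) (u ux : R -> R -> R) : Prop :=
  forall t x : R, 0 <= t <= T -> is_derive (fun y : R => u t y) x (ux t x).

Fixpoint class_C (T : R) (k : nat) (u : R -> R -> R) : Prop :=
  continuous_on (strip T) (fun p : R * R => u (fst p) (snd p)) /\
  match k with
  | O => True
  | S k' => exists ut ux : R -> R -> R,
      is_dt T u ut /\ is_dx T u ux /\ class_C T k' ut /\ class_C T k' ux
  end.

Definition wave_equation (T : R) (u : R -> R -> R) : Prop :=
  exists ut utt ux uxx : R -> R -> R,
    is_dt T u ut /\ is_dt T ut utt /\ is_dx T u ux /\ is_dx T ux uxx /\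
    forall t x : R, 0 <= t <= T -> utt t x - uxx t x = 0.

Definition TBVP_solution (f0 fT : R -> R) (T : R) (u : R -> R -> R) : Prop :=
  class_C T 2 u /\ wave_equation T u /\
  (forall x : R, u 0 x = f0 x) /\ (forall x : R, u T x = fT x).

Definition same_on_strip (T : R) (u w : R -> R -> R) : Prop :=
  forall t x : R, 0 <= t <= T -> u t x = w t x.

(** [v x = u_t(0,x)], the derivative being one-sided. *)
Definition has_input (T : R) (u : R -> R -> R) (v : R -> R) : Prop :=
  forall x : R,
    filterdiff (fun s : R => u s x)
      (within (fun s : R => 0 <= s <= T) (locally 0))
      (fun h : R => scal h (v x)).

Definition input_space (f0 fT : R -> R) (T : R) (v : R -> R) : Prop :=
  exists u : R -> R -> R, TBVP_solution f0 fT T u /\ has_input T u v.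

(** The norm of L^2[a,b]. It is only applied to inputs, which are continuous,
    so the Riemann integral exists and agrees with the Lebesgue integral. *)
Definition L2norm (a b : R) (v : R -> R) : R := sqrt (RInt (fun x => v x ^ 2) a b).

Definition input_norm (T : R) (K1 K2 : nat) (v : R -> R) : R :=
  L2norm (- (2 * INR K1 + 1) * T) ((2 * INR K2 + 1) * T) v.

Definition minimum_input_solution (f0 fT : R -> R) (T : R) (K1 K2 : nat)
    (u : R -> R -> R) : Prop :=
  TBVP_solution f0 fT T u /\
  exists v : R -> R, has_input T u v /\
    forall w : R -> R, input_space f0 fT T w ->
      input_norm T K1 K2 v <= input_norm T K1 K2 w.

Definition const_A (f0 fT : R -> R) (T : R) : R := 2 * fT 0 - f0 T - f0 (- T).

Definition const_c1 (f0 fT : R -> R) (T : R) : R :=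
  2 * Derive fT 0 - Derive f0 T - Derive f0 (- T).

Definition const_c2 (f0 fT : R -> R) (T : R) : R :=
  2 * Derive_n fT 2 0 - Derive_n f0 2 T - Derive_n f0 2 (- T).

(** [t_right k] is t_{k+1} (1 <= k <= K2) and [t_left k] is t_{k+K2+1}
    (1 <= k <= K1). The defining formulas make sense on all of R, and are used
    there; [sum_n_m a 0 (k - 1)] sums over n = 0, ..., k-1. *)
Definition t_right (f0 fT : R -> R) (T : R) (k : nat) (x : R) : R :=
  Derive f0 x
  + 2 * sum_n_m (fun n => Derive f0 (x + (2 * INR k - 2 * INR n) * T)) 0 (k - 1)
  - 2 * sum_n_m (fun n => Derive fT (x + (2 * INR k - 2 * INR n - 1) * T)) 0 (k - 1)
  - Derive f0 (x + 2 * INR k * T).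

Definition t_left (f0 fT : R -> R) (T : R) (k : nat) (x : R) : R :=
  Derive f0 x
  + 2 * sum_n_m (fun n => Derive fT (x + (2 * INR n + 1 - 2 * INR k) * T)) 0 (k - 1)
  - 2 * sum_n_m (fun n => Derive f0 (x + 2 * (INR n + 1 - INR k) * T)) 0 (k - 1)
  - Derive f0 (x - 2 * INR k * T).

(** The family t_i, with index i = 1, ..., K1 + K2 + 1. *)
Definition t_fun (f0 fT : R -> R) (T : R) (K2 i : nat) (x : R) : R :=
  if Nat.leb i 1 then 0
  else if Nat.leb i (K2 + 1) then t_right f0 fT T (i - 1) x
  else t_left f0 fT T (i - (K2 + 1)) x.

Definition t_mean (f0 fT : R -> R) (T : R) (K1 K2 : nat) (x : R) : R :=
  / INR (K1 + K2 + 1) *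
    sum_n_m (fun i => t_fun f0 fT T K2 i x) 1 (K1 + K2 + 1).

Definition const_A1 (f0 fT : R -> R) (T : R) (K1 K2 : nat) : R :=
  const_A f0 fT T - RInt (t_mean f0 fT T K1 K2) (- T) T.

(** Given by a formula that is smooth on R for smooth [f0], [fT]; hence its
    one-sided derivatives at the ends of [-T,T] are values of [Derive]. *)
Definition v_star (f0 fT : R -> R) (T : R) (K1 K2 : nat) (x : R) : R :=
  t_mean f0 fT T K1 K2 x + const_A1 f0 fT T K1 K2 / (2 * T).

(* Main.v *)
Require Import Defs.
From Stdlib Require Import Reals Lra Lia.
From Coquelicot Require Import Coquelicot.

Local Open Scope R_scope.

(** A solution with input [v] is given by d'Alembert's formula, since [u_t + u_x]
    and [u_t - u_x] are constant along characteristics ([solution_dalembert]).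
    The terminal condition then becomes a condition on [v] alone: [v] is of class
    C^1, its integral over the cell [[-T, T]] is [A], and [v (x + T) - v (x - T)]
    is a given smooth function, the jump. Conversely every such [v] is an input
    ([dalembert_solution]). In particular an input is determined by its
    restriction to [[-T, T]], and so is the solution.

    The inputs thus form an affine space whose directions are the 2T-periodic
    functions of class C^1 with mean zero. The interval of the norm consists of
    [K] cells, and on the cell with index [i] the input is a translate of
    [v - t_i]; hence for a periodic [p] the scalar product of [v] and [p] over the
    whole interval is [K] times the one of [v - t_mean] and [p] over [[-T, T]]
    ([RInt_times_periodic]). Therefore [v] has minimal norm if and only if
    [v - t_mean] is orthogonal on [[-T, T]] to all directions, that is, constant;
    the integral condition makes the constant equal to [A1 / (2 T)], so that [v]
    is [v_star] on [[-T, T]] ([minimal_eq_v_star], [v_star_minimal]).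

    It remains to see when some input agrees with [v_star] on [[-T, T]]. The jump
    equation forces the values and the derivatives at the two ends to differ by
    [c1] and [c2]; if they do, the equation itself extends [v_star] to the line
    without losing the class C^1 ([C1_extension], [v_star_compatible]). *)

(** Integrals and derivatives are typed in a normed module, whereas the ring and
    field tactics want an equation in [R]. *)
Ltac in_R := match goal with |- ?l = ?r => change (@eq R l r) end.

(** * One-sided derivatives *)

(** The derivative relative to [[a, b]] in epsilon-delta form: the trace filter of
    the time derivatives is awkward to specialise, and this form covers the
    one-sided derivatives at the ends and the ordinary ones inside. *)
Definition derive_within (a b : R) (f : R -> R) (t d : R) : Prop :=
  forall eps : R, 0 < eps -> exists delta : R, 0 < delta /\
    forall s : R, a <= s <= b -> Rabs (s - t) < delta ->
      Rabs (f s - f t - (s - t) * d) <= eps * Rabs (s - t).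

Lemma filterdiff_within_iff (a b : R) (f : R -> R) (t d : R) :
  a <= t <= b ->
  filterdiff f (within (fun s : R => a <= s <= b) (locally t))
    (fun h : R => scal h d) <-> derive_within a b f t d.
Proof.
  intros Ht; split.
  - intros [_ H] eps Heps.
    destruct (H t) with (eps := mkposreal eps Heps) as [delta Hd].
    { intros P HP; unfold within; apply (filter_imp P); auto. }
    exists delta; split; [apply cond_pos|].
    intros s Hs Hst. exact (Hd s Hst Hs).
  - intros H; split; [apply (@is_linear_scal_l R_AbsRing R_NormedModule d)|].
    intros x Hx eps.
    assert (x = t) as ->.
    {
      destruct (Req_dec x t) as [E|E]; [exact E|exfalso].
      assert (Hp : 0 < Rabs (x - t) / 2) by (assert (0 < Rabs (x - t)) by (apply Rabs_pos_lt; lra); lra).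
      assert (Hl : locally x (fun y : R => Rabs (y - x) < Rabs (x - t) / 2)).
      { exists (mkposreal _ Hp). intros y Hy; exact Hy. }
      destruct (Hx _ Hl) as [delta Hd].
      specialize (Hd t (ball_center t delta) Ht); simpl in Hd.
      rewrite Rabs_minus_sym in Hd; lra. }
    destruct (H eps (cond_pos eps)) as [delta [Hd0 Hd]].
    exists (mkposreal delta Hd0). intros s Hst Hs. exact (Hd s Hs Hst).
Qed.

Lemma derive_within_unique (a b : R) (f g : R -> R) (t d e : R) :
  a < b -> a <= t <= b -> (forall s, a <= s <= b -> f s = g s) ->
  derive_within a b f t d -> derive_within a b g t e -> d = e.
Proof.
  intros Hab Ht Hfg Hd He.
  destruct (Req_dec d e) as [E|E]; [exact E|exfalso].
  assert (Hp : 0 < Rabs (d - e) / 3) by (assert (0 < Rabs (d - e)) by (apply Rabs_pos_lt; lra); lra).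
  destruct (Hd _ Hp) as [d1 [Hd1 H1]].
  destruct (He _ Hp) as [d2 [Hd2 H2]].
  assert (Hs : exists s, a <= s <= b /\ 0 < Rabs (s - t) < Rmin d1 d2).
  { assert (0 < Rmin d1 d2) by (apply Rmin_glb_lt; assumption).
    pose (eta := Rmin (Rmin d1 d2) (b - a) / 2).
    assert (0 < eta /\ eta < Rmin d1 d2 /\ eta <= (b - a) / 2).
    { pose proof (Rmin_l (Rmin d1 d2) (b - a)); pose proof (Rmin_r (Rmin d1 d2) (b - a)).
      assert (0 < Rmin (Rmin d1 d2) (b - a)) by (apply Rmin_glb_lt; lra).
      unfold eta; lra. }
    destruct (Rle_dec t ((a + b) / 2)).
    - exists (t + eta). replace (t + eta - t) with eta by ring.
      rewrite Rabs_pos_eq; lra.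
    - exists (t - eta). replace (t - eta - t) with (- eta) by ring.
      rewrite Rabs_Ropp, Rabs_pos_eq; lra. }
  destruct Hs as [s [Hs [Hst0 Hst]]].
  pose proof (Rmin_l d1 d2); pose proof (Rmin_r d1 d2).
  specialize (H1 s Hs ltac:(lra)); specialize (H2 s Hs ltac:(lra)).
  rewrite (Hfg s Hs), (Hfg t Ht) in H1.
  assert (Hm : Rabs (s - t) * Rabs (d - e) <=
    Rabs (g s - g t - (s - t) * d) + Rabs (g s - g t - (s - t) * e)).
  { rewrite <- Rabs_mult.
    replace ((s - t) * (d - e)) with
      (- (g s - g t - (s - t) * d) + (g s - g t - (s - t) * e)) by ring.
    eapply Rle_trans; [apply Rabs_triang|]. rewrite Rabs_Ropp; lra. }
  assert (0 < Rabs (s - t) * Rabs (d - e)) by (apply Rmult_lt_0_compat; lra).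
  nra.
Qed.

Lemma is_derive_within (a b : R) (f : R -> R) (t d : R) :
  is_derive f t d -> derive_within a b f t d.
Proof.
  intros [_ H] eps Heps.
  destruct (H t) with (eps := mkposreal eps Heps) as [delta Hd]; [intros P HP; exact HP|].
  exists delta; split; [apply cond_pos|].
  intros s _ Hst. exact (Hd s Hst).
Qed.

Lemma derive_within_interior (a b : R) (f : R -> R) (t d : R) :
  a < t < b -> derive_within a b f t d -> is_derive f t d.
Proof.
  intros Ht H; split; [apply (@is_linear_scal_l R_AbsRing R_NormedModule d)|].
  intros x Hx eps.
  assert (t = x) as <- by (apply is_filter_lim_locally_unique; exact Hx).
  destruct (H eps (cond_pos eps)) as [delta [Hd0 Hd]].
  assert (Hp : 0 < Rmin delta (Rmin (t - a) (b - t))) by (repeat apply Rmin_glb_lt; lra).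
  exists (mkposreal _ Hp). intros s Hst.
  assert (Hst' : Rabs (s - t) < Rmin delta (Rmin (t - a) (b - t))) by exact Hst.
  pose proof (Rmin_l delta (Rmin (t - a) (b - t))).
  pose proof (Rmin_r delta (Rmin (t - a) (b - t))).
  pose proof (Rmin_l (t - a) (b - t)); pose proof (Rmin_r (t - a) (b - t)).
  apply Rabs_def2 in Hst' as Hst2.
  apply (Hd s); lra.
Qed.

(** Two functions that agree on one side of a point only still have the same
    derivative there. *)
Lemma derive_agree (a b : R) (f g : R -> R) (t d e : R) :
  a < b -> a <= t <= b -> (forall s, a <= s <= b -> f s = g s) ->
  is_derive f t d -> is_derive g t e -> d = e.
Proof.
  intros Hab Ht Hfg Hd He.
  apply (derive_within_unique a b f g t); auto using is_derive_within.
Qed.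

(** * Functions of class C^k on the line *)

Lemma is_derive_shift (f df : R -> R) (c x : R) :
  (forall x, is_derive f x (df x)) -> is_derive (fun y => f (y + c)) x (df (x + c)).
Proof.
  intros H. evar_last.
  - apply (is_derive_comp f (fun y => y + c) x); [apply H|auto_derive; [auto|reflexivity]].
  - apply (Rmult_1_l (df (x + c))).
Qed.

Lemma is_derive_lin (a b : R) (f df g dg : R -> R) (x : R) :
  (forall x, is_derive f x (df x)) -> (forall x, is_derive g x (dg x)) ->
  is_derive (fun x => a * f x + b * g x) x (a * df x + b * dg x).
Proof.
  intros Hf Hg. apply (is_derive_plus (fun x => a * f x) (fun x => b * g x));
    [apply (is_derive_scal f x a)|apply (is_derive_scal g x b)]; auto.
Qed.

(** Continuity is a conjunct at every level so that [Ck_continuous] reads it off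
    for all [k] alike. *)
Fixpoint Ck (k : nat) (f : R -> R) : Prop :=
  (forall x, continuous f x) /\
  match k with
  | O => True
  | S k' => exists df, (forall x, is_derive f x (df x)) /\ Ck k' df
  end.

Lemma Ck_continuous k f : Ck k f -> forall x, continuous f x.
Proof. destruct k; intros [H _]; exact H. Qed.

Lemma Ck_derive k f df :
  (forall x, is_derive f x (df x)) -> Ck k df -> Ck (S k) f.
Proof.
  intros H H'; split; [|exists df; auto].
  intros x; apply (ex_derive_continuous f); exists (df x); apply H.
Qed.

Lemma Ck_Derive k f :
  Ck (S k) f -> (forall x, is_derive f x (Derive f x)) /\ Ck k (Derive f).
Proof.
  intros [_ [df [H H']]].
  assert (E : forall x, Derive f x = df x) by (intros x; apply is_derive_unique, H).
  split; [intros x; rewrite E; apply H|].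
  clear H. revert f df E H'.
  induction k as [|k IH]; intros f df E H'; (split; [intros x; apply (continuous_ext df); [auto|apply Ck_continuous with (1 := H')]|]); [exact I|].
  destruct H' as [_ [d2 [H2 H2']]].
  exists d2; split; [|exact H2'].
  intros x; apply (is_derive_ext df); auto.
Qed.

Lemma Ck_ext k f g : (forall x, f x = g x) -> Ck k f -> Ck k g.
Proof.
  intros E H; destruct k; destruct H as [Hc H].
  - split; [|exact I]. intros x; apply (continuous_ext f); auto.
  - destruct H as [df [Hd H]].
    apply Ck_derive with df; auto.
    intros x; apply (is_derive_ext f); auto.
Qed.

Lemma smooth_Ck_Derive_n f k n : smooth f -> Ck k (Derive_n f n).
Proof.
  intros Hf.
  assert (Hd : forall m x, is_derive (Derive_n f m) x (Derive_n f (S m) x)).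
  { intros m x. apply Derive_correct, (Hf (S m) x). }
  revert n; induction k as [|k IH]; intros n.
  - split; [|exact I].
    intros x; apply (ex_derive_continuous (Derive_n f n)); eexists; apply Hd.
  - apply Ck_derive with (Derive_n f (S n)); auto.
Qed.

Lemma Ck_const k c : Ck k (fun _ => c).
Proof.
  revert c; induction k as [|k IH]; intros c.
  - split; [intros x; apply continuous_const|exact I].
  - apply Ck_derive with (fun _ => 0); [|apply IH].
    intros x; apply (@is_derive_const R_AbsRing R_NormedModule).
Qed.

Lemma Ck_lin k a b f g : Ck k f -> Ck k g -> Ck k (fun x => a * f x + b * g x).
Proof.
  revert f g; induction k as [|k IH]; intros f g Hf Hg.
  - split; [|exact I]. intros x.
    apply (continuous_plus (fun x => a * f x) (fun x => b * g x)).
    + apply (continuous_scal_r a f), Ck_continuous with (1 := Hf).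
    + apply (continuous_scal_r b g), Ck_continuous with (1 := Hg).
  - destruct Hf as [_ [df [Hf1 Hf2]]]; destruct Hg as [_ [dg [Hg1 Hg2]]].
    apply Ck_derive with (fun x => a * df x + b * dg x); [|apply IH; auto].
    intros x; apply is_derive_lin; assumption.
Qed.

Lemma Ck_shift k c f : Ck k f -> Ck k (fun x => f (x + c)).
Proof.
  revert f; induction k as [|k IH]; intros f Hf.
  - split; [|exact I]. intros x.
    apply (continuous_comp (fun x => x + c) f).
    + apply (ex_derive_continuous (fun x => x + c)); auto_derive; auto.
    + apply Ck_continuous with (1 := Hf).
  - destruct Hf as [_ [df [Hf1 Hf2]]].
    apply Ck_derive with (fun x => df (x + c)); [|apply IH; auto].
    intros x; apply is_derive_shift, Hf1.
Qed.

Lemma Ck_sum k (F : nat -> R -> R) n m :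
  (forall i, Ck k (F i)) -> Ck k (fun x => sum_n_m (fun i => F i x) n m).
Proof.
  intros H.
  induction m as [|m IH].
  - destruct n.
    + apply (Ck_ext k (F O)); [intros x; now rewrite sum_n_n|auto].
    + apply (Ck_ext k (fun _ => 0)); [intros x; now rewrite sum_n_m_zero by lia|apply Ck_const].
  - destruct (Nat.le_gt_cases n (S m)).
    + apply (Ck_ext k (fun x => 1 * sum_n_m (fun i => F i x) n m + 1 * F (S m) x)).
      * intros x; rewrite sum_n_Sm by lia. unfold plus; simpl; ring.
      * apply Ck_lin; auto.
    + apply (Ck_ext k (fun _ => 0)); [intros x; now rewrite sum_n_m_zero by lia|apply Ck_const].
Qed.

Lemma Ck_mult1 f g : Ck 1 f -> Ck 1 g -> Ck 1 (fun x => f x * g x).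
Proof.
  intros Hf Hg.
  destruct (Ck_Derive 0 f Hf) as [Hf1 Hf2]; destruct (Ck_Derive 0 g Hg) as [Hg1 Hg2].
  apply Ck_derive with (fun x => Derive f x * g x + f x * Derive g x).
  - intros x; apply (is_derive_mult f g); auto. intros; apply Rmult_comm.
  - split; [|exact I]. intros x.
    apply (continuous_plus (fun x => Derive f x * g x) (fun x => f x * Derive g x));
      [apply (continuous_mult (Derive f) g)|apply (continuous_mult f (Derive g))];
      eapply Ck_continuous; eassumption.
Qed.

Lemma continuous_product (f g : R -> R) :
  (forall x, continuous f x) -> (forall x, continuous g x) ->
  forall x, continuous (fun y => f y * g y) x.
Proof. intros Hf Hg x; apply (continuous_mult f g); auto. Qed.

Lemma continuous_lin (a b : R) (f g : R -> R) :
  (forall x, continuous f x) -> (forall x, continuous g x) ->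
  forall x, continuous (fun y => a * f y + b * g y) x.
Proof. intros Hf Hg. apply (Ck_continuous 0), Ck_lin; split; auto. Qed.

Lemma continuous_shift (f : R -> R) (c : R) :
  (forall x, continuous f x) -> forall x, continuous (fun y => f (y + c)) x.
Proof. intros Hf. apply (Ck_continuous 0), Ck_shift; split; auto. Qed.

(** * Integrals of continuous functions *)

Lemma ex_RInt_cont (f : R -> R) a b : (forall x, continuous f x) -> ex_RInt f a b.
Proof. intros H; apply (ex_RInt_continuous f); auto. Qed.

Lemma RInt_lin (a b : R) (f g : R -> R) x y :
  (forall x, continuous f x) -> (forall x, continuous g x) ->
  RInt (fun s => a * f s + b * g s) x y = a * RInt f x y + b * RInt g x y.
Proof.
  intros Hf Hg.
  assert (Ef : RInt (fun s => a * f s) x y = a * RInt f x y)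
    by (apply (RInt_scal f x y a), ex_RInt_cont; auto).
  assert (Eg : RInt (fun s => b * g s) x y = b * RInt g x y)
    by (apply (RInt_scal g x y b), ex_RInt_cont; auto).
  rewrite <- Ef, <- Eg.
  apply (RInt_plus (fun s => a * f s) (fun s => b * g s));
    apply ex_RInt_cont; intros s;
    [apply (continuous_scal_r a f)|apply (continuous_scal_r b g)]; auto.
Qed.

Lemma RInt_shift (f : R -> R) c a b :
  (forall x, continuous f x) ->
  RInt (fun x => f (x + c)) a b = RInt f (a + c) (b + c).
Proof.
  intros Hf.
  replace (a + c) with (1 * a + c) by ring. replace (b + c) with (1 * b + c) by ring.
  rewrite <- (RInt_comp_lin f 1 c a b) by (apply ex_RInt_cont; auto).
  apply RInt_ext; intros x _. now rewrite !Rmult_1_l.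
Qed.

Lemma RInt_split (f : R -> R) a b c :
  (forall x, continuous f x) -> RInt f a c = RInt f a b + RInt f b c.
Proof.
  intros Hf; symmetry; apply (RInt_Chasles f a b c); apply ex_RInt_cont; auto.
Qed.

Lemma RInt_is_derive (f : R -> R) a x :
  (forall x, continuous f x) -> is_derive (fun y => RInt f a y) x (f x).
Proof.
  intros Hf; apply (is_derive_RInt f (fun y => RInt f a y) a x); [|auto].
  apply filter_forall; intros y; apply (RInt_correct f), ex_RInt_cont; auto.
Qed.

Lemma zero_derivative_const (f : R -> R) :
  (forall x, is_derive f x 0) -> forall x y, f x = f y.
Proof.
  intros H x y.
  destruct (Rtotal_order x y) as [L|[E|L]].
  - apply (eq_is_derive f x y); auto.
  - now rewrite E.
  - symmetry; apply (eq_is_derive f y x); auto.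
Qed.

(** The primitive is nondecreasing and takes equal values at both ends, hence it
    is constant and its derivative vanishes inside. *)
Lemma RInt_nonneg_eq_0 (f : R -> R) a b :
  (forall x, continuous f x) -> (forall x, 0 <= f x) -> RInt f a b = 0 ->
  forall x, a < x < b -> f x = 0.
Proof.
  intros Hc Hp H0 x Hx.
  assert (Hpos : forall s t, s <= t -> 0 <= RInt f s t).
  { intros s t Hst; apply RInt_ge_0; auto. apply ex_RInt_cont; auto. }
  apply (derive_agree a b (fun y => RInt f a y) (fun _ => 0) x); [lra|lra| | |].
  - intros s Hs.
    pose proof (RInt_split f a s b Hc).
    pose proof (Hpos a s ltac:(lra)); pose proof (Hpos s b ltac:(lra)); lra.
  - apply RInt_is_derive; auto.
  - apply (@is_derive_const R_AbsRing R_NormedModule).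
Qed.

Lemma continuous_zero_closure (f : R -> R) a b :
  a < b -> (forall x, continuous f x) -> (forall x, a < x < b -> f x = 0) ->
  forall x, a <= x <= b -> f x = 0.
Proof.
  intros Hab Hc H x Hx.
  destruct (Req_dec (f x) 0) as [E|E]; [exact E|exfalso].
  assert (Hp : 0 < Rabs (f x)) by (apply Rabs_pos_lt; auto).
  destruct (Hc x (fun y => Rabs (y - f x) < Rabs (f x))) as [d Hd].
  { exists (mkposreal _ Hp); intros y Hy; exact Hy. }
  assert (Hs : exists s, a < s < b /\ Rabs (s - x) < d).
  { pose proof (cond_pos d).
    pose (eta := Rmin d (b - a) / 2).
    assert (0 < eta /\ eta < d /\ eta <= (b - a) / 2).
    { pose proof (Rmin_l d (b - a)); pose proof (Rmin_r d (b - a)).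
      assert (0 < Rmin d (b - a)) by (apply Rmin_glb_lt; lra).
      unfold eta; lra. }
    destruct (Rle_dec x ((a + b) / 2)).
    - exists (x + eta / 2). replace (x + eta / 2 - x) with (eta / 2) by ring.
      rewrite Rabs_pos_eq; lra.
    - exists (x - eta / 2). replace (x - eta / 2 - x) with (- (eta / 2)) by ring.
      rewrite Rabs_Ropp, Rabs_pos_eq; lra. }
  destruct Hs as [s [Hs Hsx]].
  specialize (Hd s Hsx). simpl in Hd. rewrite (H s Hs) in Hd.
  rewrite Rminus_0_l, Rabs_Ropp in Hd; lra.
Qed.

(** * Extending a function by a difference equation *)

Lemma continuous_Rabs_shift a x : continuous (fun y => Rabs (y + - a)) x.
Proof. apply (continuous_shift Rabs (- a)), continuous_Rabs. Qed.

Lemma continuous_Rmin a x : continuous (fun y => Rmin y a) x.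
Proof.
  apply (continuous_ext (fun y => 1 / 2 * (y + a) + - (1 / 2) * Rabs (y + - a))).
  - intros y; unfold Rmin, Rabs; destruct (Rle_dec y a), (Rcase_abs (y + - a)); lra.
  - apply (continuous_lin _ _ (fun y => y + a) (fun y => Rabs (y + - a))).
    + apply (continuous_shift (fun y => y) a); intros y; apply continuous_id.
    + apply continuous_Rabs_shift.
Qed.

Lemma continuous_Rmax a x : continuous (fun y => Rmax y a) x.
Proof.
  apply (continuous_ext (fun y => 1 / 2 * (y + a) + 1 / 2 * Rabs (y + - a))).
  - intros y; unfold Rmax, Rabs; destruct (Rle_dec y a), (Rcase_abs (y + - a)); lra.
  - apply (continuous_lin _ _ (fun y => y + a) (fun y => Rabs (y + - a))).
    + apply (continuous_shift (fun y => y) a); intros y; apply continuous_id.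
    + apply continuous_Rabs_shift.
Qed.

(** Adding the two clamped functions and removing the common value makes the
    continuity of a piecewise definition a matter of composition. *)
Definition glue (a : R) (p q : R -> R) (x : R) : R :=
  p (Rmin x a) + q (Rmax x a) - p a.

Lemma glue_left a p q x : p a = q a -> x <= a -> glue a p q x = p x.
Proof. intros E H; unfold glue; rewrite Rmin_left, Rmax_right by auto; lra. Qed.

Lemma glue_right a p q x : p a = q a -> a <= x -> glue a p q x = q x.
Proof. intros E H; unfold glue; rewrite Rmin_right, Rmax_left by auto; lra. Qed.

Lemma glue_continuous a p q :
  (forall x, continuous p x) -> (forall x, continuous q x) ->
  forall x, continuous (glue a p q) x.
Proof.
  intros Hp Hq x.
  apply (continuous_minus (fun y => p (Rmin y a) + q (Rmax y a)) (fun _ => p a));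
    [|apply continuous_const].
  apply (continuous_plus (fun y => p (Rmin y a)) (fun y => q (Rmax y a))).
  - apply (continuous_comp (fun y => Rmin y a) p); [apply continuous_Rmin|apply Hp].
  - apply (continuous_comp (fun y => Rmax y a) q); [apply continuous_Rmax|apply Hq].
Qed.

(** The extension is the pointwise limit of the iterates of the step that keeps
    [w] up to [T] and puts [r (x - 2 T) + g (x - T)] after [T]. Each iterate is
    already final on an interval that grows with its index, so the limit agrees
    locally with an iterate and is continuous. *)
Lemma continuous_extension_right (T : R) (w g : R -> R) :
  0 < T -> (forall x, continuous w x) -> (forall x, continuous g x) ->
  w T = w (- T) + g 0 ->
  exists v : R -> R, (forall x, continuous v x) /\
    (forall x, x <= T -> v x = w x) /\
    (forall x, 0 <= x -> v (x + T) = v (x - T) + g x).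
Proof.
  intros HT Hw Hg Hm.
  pose (step := fun (r : R -> R) (x : R) => 1 * r (x + - (2 * T)) + 1 * g (x + - T)).
  pose (r := fun n : nat => Nat.iter n (fun r => glue T w (step r)) w).
  assert (Hleft : forall n x, x <= T -> r n x = w x).
  { induction n as [|n IH]; intros x Hx; [reflexivity|].
    apply (glue_left T w (step (r n))); [|exact Hx].
    unfold step. rewrite IH by lra.
    replace (T + - (2 * T)) with (- T) by ring. replace (T + - T) with 0 by ring. lra. }
  assert (Hjoin : forall n, w T = step (r n) T).
  { intros n; unfold step. rewrite Hleft by lra.
    replace (T + - (2 * T)) with (- T) by ring. replace (T + - T) with 0 by ring. lra. }
  assert (Hright : forall n x, T <= x -> r (S n) x = r n (x + - (2 * T)) + g (x + - T)).
  { intros n x Hx. change (r (S n) x) with (glue T w (step (r n)) x).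
    rewrite glue_right by auto. unfold step; ring. }
  assert (Hcont : forall n x, continuous (r n) x).
  { induction n as [|n IH]; [exact Hw|].
    apply (glue_continuous T w (step (r n))); [exact Hw|].
    apply (continuous_lin 1 1 (fun x => r n (x + - (2 * T))) (fun x => g (x + - T)));
      apply continuous_shift; auto. }
  assert (Hstep : forall n x, x <= (2 * INR n + 1) * T -> r (S n) x = r n x).
  { induction n as [|n IH]; intros x Hx.
    - simpl in Hx. transitivity (w x); [|symmetry]; apply Hleft; lra.
    - destruct (Rle_dec x T) as [L|L]; [transitivity (w x); [|symmetry]; apply Hleft; lra|].
      assert (L' : T <= x) by lra. rewrite (Hright (S n) x L'), (Hright n x L').
      rewrite IH; [reflexivity|]. rewrite S_INR in Hx. lra. }
  assert (Hstable : forall n m x, (n <= m)%nat -> x <= (2 * INR n + 1) * T -> r m x = r n x).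
  { intros n m x Hnm Hx. induction Hnm as [|m Hnm IH]; [reflexivity|].
    rewrite Hstep; [exact IH|].
    apply le_INR in Hnm. nra. }
  pose (N := fun x : R => Z.to_nat (up (x / T))).
  assert (HN : forall x, x <= (2 * INR (N x) + 1) * T).
  { intros x. destruct (archimed (x / T)) as [Hup _].
    assert (IZR (up (x / T)) <= INR (N x)).
    { unfold N. rewrite INR_IZR_INZ. apply IZR_le. lia. }
    assert (x / T * T = x) by (field; lra).
    pose proof (pos_INR (N x)). nra. }
  exists (fun x => r (N x) x).
  assert (Hv : forall n x, x <= (2 * INR n + 1) * T -> r (N x) x = r n x).
  { intros n x Hx. destruct (Nat.le_ge_cases n (N x)).
    - apply Hstable; auto.
    - symmetry; apply Hstable; auto. }
  split; [|split].
  - intros x.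
    apply (continuous_ext_loc _ (r (N (x + 1)))); [|apply Hcont].
    exists (mkposreal 1 Rlt_0_1). intros y Hy.
    symmetry; apply Hv.
    assert (Hy' : Rabs (y - x) < 1) by exact Hy.
    apply Rabs_def2 in Hy'. specialize (HN (x + 1)). lra.
  - intros x Hx; apply Hleft, Hx.
  - intros x Hx.
    rewrite (Hv (S (N (x - T))) (x + T)).
    + rewrite Hright by lra.
      replace (x + T + - (2 * T)) with (x - T) by ring.
      replace (x + T + - T) with x by ring. reflexivity.
    + specialize (HN (x - T)). rewrite S_INR. lra.
Qed.

(** To the left, the reflection [x |-> - x] turns the equation with right-hand
    side [g] into the one with right-hand side [- g (- x)]. *)
Lemma continuous_extension (T : R) (w g : R -> R) :
  0 < T -> (forall x, continuous w x) -> (forall x, continuous g x) ->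
  w T = w (- T) + g 0 ->
  exists v : R -> R, (forall x, continuous v x) /\
    (forall x, - T <= x <= T -> v x = w x) /\
    (forall x, v (x + T) - v (x - T) = g x).
Proof.
  intros HT Hw Hg Hm.
  assert (Hopp : forall f : R -> R, (forall x, continuous f x) ->
    forall x, continuous (fun y => f (- y)) x).
  { intros f Hf x. apply (continuous_comp (fun y => - y) f); [|apply Hf].
    apply (ex_derive_continuous (fun y => - y)); auto_derive; auto. }
  destruct (continuous_extension_right T w g HT Hw Hg Hm) as [vr [Hrc [Hrw Hrg]]].
  destruct (continuous_extension_right T (fun x => w (- x)) (fun x => - g (- x)) HT)
    as [vl [Hlc [Hlw Hlg]]].
  - apply Hopp, Hw.
  - intros x; apply (continuous_opp (fun y => g (- y))); apply Hopp, Hg.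
  - rewrite Ropp_involutive, Ropp_0. lra.
  - exists (glue 0 (fun x => vl (- x)) vr).
    assert (E0 : vl (- 0) = vr 0).
    { rewrite Hlw, Hrw by lra. now rewrite Ropp_involutive. }
    assert (HL : forall x, x <= T -> glue 0 (fun x => vl (- x)) vr x = vl (- x)).
    { intros x Hx. destruct (Rle_dec x 0).
      - apply (glue_left 0 (fun x => vl (- x)) vr); auto.
      - rewrite glue_right by (auto; lra).
        rewrite Hlw, Hrw, Ropp_involutive by lra. reflexivity. }
    assert (HR : forall x, - T <= x -> glue 0 (fun x => vl (- x)) vr x = vr x).
    { intros x Hx. destruct (Rle_dec 0 x).
      - apply (glue_right 0 (fun x => vl (- x)) vr); auto.
      - rewrite glue_left by (auto; lra).
        rewrite Hlw, Hrw, Ropp_involutive by lra. reflexivity. }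
    split; [|split].
    + apply glue_continuous; [apply Hopp, Hlc|apply Hrc].
    + intros x Hx. rewrite HR, Hrw by lra. reflexivity.
    + intros x. destruct (Rle_dec 0 x).
      * rewrite !HR by lra. rewrite Hrg by lra. ring.
      * rewrite !HL by lra.
        replace (- (x - T)) with (- x + T) by ring.
        rewrite Hlg by lra.
        rewrite Ropp_involutive.
        replace (- (x + T)) with (- x - T) by ring. ring.
Qed.

(** Only the derivative has to be extended: the primitive of the extended
    derivative satisfies the integrated difference equation up to a constant,
    and the value at 0 says that this constant vanishes. *)
Lemma C1_extension (T : R) (w g : R -> R) :
  0 < T -> Ck 1 w -> Ck 1 g ->
  w T = w (- T) + g 0 -> Derive w T = Derive w (- T) + Derive g 0 ->
  exists v : R -> R, Ck 1 v /\
    (forall x, - T <= x <= T -> v x = w x) /\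
    (forall x, v (x + T) - v (x - T) = g x).
Proof.
  intros HT Hw Hg Hm Hdm.
  destruct (Ck_Derive 0 w Hw) as [Hw1 Hw2]; destruct (Ck_Derive 0 g Hg) as [Hg1 Hg2].
  destruct (continuous_extension T (Derive w) (Derive g) HT) as [dv [Hc [Hdw Hdg]]]; auto.
  { apply (Ck_continuous 0), Hw2. } { apply (Ck_continuous 0), Hg2. }
  pose (v := fun x => w 0 + RInt dv 0 x).
  assert (Hvd : forall x, is_derive v x (dv x)).
  { intros x. evar_last.
    - apply (is_derive_plus (fun _ => w 0) (fun y => RInt dv 0 y) x).
      + apply (@is_derive_const R_AbsRing R_NormedModule).
      + apply RInt_is_derive, Hc.
    - apply (plus_zero_l (dv x)). }
  assert (Hvw : forall x, - T <= x <= T -> v x = w x).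
  { intros x Hx. unfold v.
    rewrite (RInt_ext dv (Derive w)).
    - rewrite RInt_Derive.
      + ring.
      + intros; eexists; apply Hw1.
      + intros; apply (Ck_continuous 0), Hw2.
    - intros y Hy. apply Hdw.
      unfold Rmin, Rmax in Hy; destruct (Rle_dec 0 x); lra. }
  exists v; split; [|split; [exact Hvw|]].
  - apply Ck_derive with dv; [exact Hvd|split; auto].
  - intros x.
    assert (Hz : forall y, is_derive (fun y => v (y + T) - v (y - T) - g y) y 0).
    { intros y. evar_last.
      - apply (is_derive_minus (fun y => v (y + T) - v (y - T)) g); [|apply Hg1].
        apply (is_derive_minus (fun y => v (y + T)) (fun y => v (y + - T)));
          apply (is_derive_shift v dv), Hvd.
      - change (dv (y + T) - dv (y - T) - Derive g y = 0). rewrite Hdg; ring. }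
    pose proof (zero_derivative_const _ Hz x 0) as E; simpl in E.
    rewrite Rplus_0_l, Rminus_0_l, (Hvw T), (Hvw (- T)) in E by lra. lra.
Qed.

(** * The difference equation on the cells *)

(** The derivative of the terminal condition in d'Alembert's formula prescribes
    [v (x + T) - v (x - T)]. At 0 its value and derivative are the constants
    [c1] and [c2]. *)
Definition jump (f0 fT : R -> R) (T x : R) : R :=
  2 * Derive fT x - Derive f0 (x + T) - Derive f0 (x - T).

Lemma sum_first (a : nat -> R) (m : nat) :
  sum_n_m a 0 (S m) = a O + sum_n_m (fun n => a (S n)) 0 m.
Proof. rewrite sum_Sn_m by lia. rewrite <- sum_n_m_S. reflexivity. Qed.

(** Up to sign the functions [t_i] are partial sums of jumps: [v - t_i] is the
    translate of [v] by the cell with index [i]. *)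
Lemma shift_right (f0 fT v : R -> R) (T : R) :
  (forall x, v (x + T) - v (x - T) = jump f0 fT T x) ->
  forall k x, v (x + 2 * INR (S k) * T) = v x - t_right f0 fT T (S k) x.
Proof.
  intros Hv k x.
  assert (Hs : forall k, v (x + 2 * INR (S k) * T) = v (x + 2 * INR k * T)
     + 2 * Derive fT (x + (2 * INR k + 1) * T) - Derive f0 (x + 2 * INR (S k) * T)
     - Derive f0 (x + 2 * INR k * T)).
  { intros j. specialize (Hv (x + (2 * INR j + 1) * T)). unfold jump in Hv.
    rewrite S_INR.
    replace (x + (2 * INR j + 1) * T + T) with (x + 2 * (INR j + 1) * T) in Hv by ring.
    replace (x + (2 * INR j + 1) * T - T) with (x + 2 * INR j * T) in Hv by ring.
    lra. }
  induction k as [|k IH].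
  - rewrite Hs. unfold t_right. simpl Nat.sub. rewrite !sum_n_n. simpl INR.
    replace (x + 2 * 0 * T) with x by ring.
    replace (x + (2 * 0 + 1) * T) with (x + T) by ring.
    replace (x + (2 * 1 - 2 * 0) * T) with (x + 2 * T) by ring.
    replace (x + (2 * 1 - 2 * 0 - 1) * T) with (x + T) by ring.
    replace (x + 2 * 1 * T) with (x + 2 * T) by ring. ring.
  - rewrite Hs, IH. unfold t_right.
    replace (S (S k) - 1)%nat with (S k) by lia. replace (S k - 1)%nat with k by lia.
    rewrite !sum_first.
    rewrite (sum_n_m_ext (fun n => Derive f0 (x + (2 * INR (S (S k)) - 2 * INR (S n)) * T))
      (fun n => Derive f0 (x + (2 * INR (S k) - 2 * INR n) * T))).
    2: { intros n; f_equal. rewrite !S_INR. ring. }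
    rewrite (sum_n_m_ext (fun n => Derive fT (x + (2 * INR (S (S k)) - 2 * INR (S n) - 1) * T))
      (fun n => Derive fT (x + (2 * INR (S k) - 2 * INR n - 1) * T))).
    2: { intros n; f_equal. rewrite !S_INR. ring. }
    replace (x + (2 * INR (S (S k)) - 2 * INR 0) * T) with (x + 2 * INR (S (S k)) * T) by (simpl (INR 0); ring).
    replace (x + (2 * INR (S (S k)) - 2 * INR 0 - 1) * T) with (x + (2 * INR (S k) + 1) * T)
      by (rewrite (S_INR (S k)); simpl (INR 0); ring).
    ring.
Qed.

Lemma shift_left (f0 fT v : R -> R) (T : R) :
  (forall x, v (x + T) - v (x - T) = jump f0 fT T x) ->
  forall k x, v (x - 2 * INR (S k) * T) = v x - t_left f0 fT T (S k) x.
Proof.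
  intros Hv k x.
  assert (Hs : forall k, v (x - 2 * INR (S k) * T) = v (x - 2 * INR k * T)
     - 2 * Derive fT (x - (2 * INR k + 1) * T) + Derive f0 (x - 2 * INR (S k) * T)
     + Derive f0 (x - 2 * INR k * T)).
  { intros j. specialize (Hv (x - (2 * INR j + 1) * T)). unfold jump in Hv.
    rewrite S_INR.
    replace (x - (2 * INR j + 1) * T + T) with (x - 2 * INR j * T) in Hv by ring.
    replace (x - (2 * INR j + 1) * T - T) with (x - 2 * (INR j + 1) * T) in Hv by ring.
    lra. }
  induction k as [|k IH].
  - rewrite Hs. unfold t_left. simpl Nat.sub. rewrite !sum_n_n. simpl INR.
    replace (x - 2 * 0 * T) with x by ring.
    replace (x - (2 * 0 + 1) * T) with (x - T) by ring.
    replace (x + (2 * 0 + 1 - 2 * 1) * T) with (x - T) by ring.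
    replace (x + 2 * (0 + 1 - 1) * T) with x by ring. ring.
  - rewrite Hs, IH. unfold t_left.
    replace (S (S k) - 1)%nat with (S k) by lia. replace (S k - 1)%nat with k by lia.
    rewrite !sum_first.
    rewrite (sum_n_m_ext (fun n => Derive fT (x + (2 * INR (S n) + 1 - 2 * INR (S (S k))) * T))
      (fun n => Derive fT (x + (2 * INR n + 1 - 2 * INR (S k)) * T))).
    2: { intros n; f_equal. rewrite !S_INR. ring. }
    rewrite (sum_n_m_ext (fun n => Derive f0 (x + 2 * (INR (S n) + 1 - INR (S (S k))) * T))
      (fun n => Derive f0 (x + 2 * (INR n + 1 - INR (S k)) * T))).
    2: { intros n; f_equal. rewrite !S_INR. ring. }
    replace (x + (2 * INR 0 + 1 - 2 * INR (S (S k))) * T) with (x - (2 * INR (S k) + 1) * T)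
      by (rewrite (S_INR (S k)); simpl (INR 0); ring).
    replace (x + 2 * (INR 0 + 1 - INR (S (S k))) * T) with (x - 2 * INR (S k) * T)
      by (rewrite (S_INR (S k)); simpl (INR 0); ring).
    ring.
Qed.

Lemma periodic_shift (T : R) (p : R -> R) :
  (forall x, p (x + T) - p (x - T) = 0) ->
  forall k x, p (x + 2 * INR k * T) = p x /\ p (x - 2 * INR k * T) = p x.
Proof.
  intros Hp k x; induction k as [|k [IH1 IH2]].
  - simpl; split; f_equal; ring.
  - rewrite !S_INR; split.
    + specialize (Hp (x + (2 * INR k + 1) * T)).
      replace (x + (2 * INR k + 1) * T + T) with (x + 2 * (INR k + 1) * T) in Hp by ring.
      replace (x + (2 * INR k + 1) * T - T) with (x + 2 * INR k * T) in Hp by ring. lra.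
    + specialize (Hp (x - (2 * INR k + 1) * T)).
      replace (x - (2 * INR k + 1) * T + T) with (x - 2 * INR k * T) in Hp by ring.
      replace (x - (2 * INR k + 1) * T - T) with (x - 2 * (INR k + 1) * T) in Hp by ring. lra.
Qed.

Lemma periodic_zero (T : R) (p : R -> R) :
  0 < T -> (forall x, p (x + T) - p (x - T) = 0) ->
  (forall x, - T <= x <= T -> p x = 0) -> forall x, p x = 0.
Proof.
  intros HT Hp H0.
  assert (H : forall n x, - (2 * INR n + 1) * T <= x <= (2 * INR n + 1) * T -> p x = 0).
  { induction n as [|n IH]; intros x Hx.
    - simpl in Hx; apply H0; lra.
    - rewrite S_INR in Hx.
      destruct (Rle_dec x (- T)); [|destruct (Rle_dec T x); [|apply H0; lra]].
      + specialize (Hp (x + T)). replace (x + T - T) with x in Hp by ring.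
        rewrite IH in Hp; [lra|]. pose proof (pos_INR n); nra.
      + specialize (Hp (x - T)). replace (x - T + T) with x in Hp by ring.
        rewrite (IH (x - T - T)) in Hp; [lra|]. pose proof (pos_INR n); nra. }
  intros x. destruct (INR_archimed T (Rabs x) HT) as [n Hn].
  apply (H n). pose proof (pos_INR n). pose proof (Rle_abs x).
  pose proof (Rle_abs (- x)). rewrite Rabs_Ropp in *. nra.
Qed.

Lemma RInt_sum (F : nat -> R -> R) a b n m :
  (forall i, Ck 0 (F i)) ->
  RInt (fun x => sum_n_m (fun i => F i x) n m) a b = sum_n_m (fun i => RInt (F i) a b) n m.
Proof.
  intros HF.
  assert (Hz : forall m, (m < n)%nat ->
    RInt (fun x => sum_n_m (fun i => F i x) n m) a b = sum_n_m (fun i => RInt (F i) a b) n m).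
  { intros j Hj. rewrite sum_n_m_zero by lia.
    rewrite (RInt_ext _ (fun _ => 0)) by (intros x _; now rewrite sum_n_m_zero by lia).
    rewrite RInt_const. exact (Rmult_0_r (b - a)). }
  induction m as [|m IH].
  - destruct n; [|apply Hz; lia].
    rewrite sum_n_n. apply RInt_ext; intros x _; now rewrite sum_n_n.
  - destruct (Nat.le_gt_cases n (S m)); [|apply Hz; lia].
    rewrite sum_n_Sm by lia. rewrite <- IH.
    rewrite (RInt_ext _ (fun x => 1 * sum_n_m (fun i => F i x) n m + 1 * F (S m) x)).
    + rewrite RInt_lin; [unfold plus; simpl; ring| |].
      * apply (Ck_continuous 0), Ck_sum, HF.
      * apply (Ck_continuous 0), HF.
    + intros x _. rewrite sum_n_Sm by lia. unfold plus; simpl; ring.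
Qed.

(** The interval of the norm consists of [K1 + K2 + 1] cells of length [2 T]; the
    index is 1 for the central cell, then [2, ..., K2 + 1] to the right, then
    [K2 + 2, ...] to the left, as for the family [t_fun]. *)
Lemma RInt_cells (T : R) (f : R -> R) (F : nat -> R -> R) (K1 K2 : nat) :
  Ck 0 f -> (forall i, Ck 0 (F i)) ->
  (forall x, F 1%nat x = f x) ->
  (forall k x, (1 <= k <= K2)%nat -> F (k + 1)%nat x = f (x + 2 * INR k * T)) ->
  (forall k x, (1 <= k)%nat -> F (k + K2 + 1)%nat x = f (x - 2 * INR k * T)) ->
  RInt f (- (2 * INR K1 + 1) * T) ((2 * INR K2 + 1) * T) =
  RInt (fun x => sum_n_m (fun i => F i x) 1 (K1 + K2 + 1)) (- T) T.
Proof.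
  intros Hf HF H1 HR HL.
  assert (Hc := Ck_continuous 0 f Hf).
  rewrite RInt_sum by exact HF.
  assert (ER : forall k, (k <= K2)%nat ->
    sum_n_m (fun i => RInt (F i) (- T) T) 1 (k + 1) = RInt f (- T) ((2 * INR k + 1) * T)).
  { induction k as [|k IH]; intros Hk.
    - simpl Nat.add. rewrite sum_n_n. simpl (INR 0).
      replace ((2 * 0 + 1) * T) with T by ring.
      apply RInt_ext; intros x _; apply H1.
    - replace (S k + 1)%nat with (S (k + 1)) by lia.
      rewrite sum_n_Sm, IH by lia.
      rewrite (RInt_split f (- T) ((2 * INR k + 1) * T) ((2 * INR (S k) + 1) * T)) by exact Hc.
      apply (f_equal2 Rplus); [reflexivity|].
      rewrite (RInt_ext _ (fun x => f (x + 2 * INR (S k) * T))).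
      + rewrite RInt_shift by exact Hc. rewrite S_INR; f_equal; ring.
      + intros x _. rewrite <- HR by lia. f_equal; lia. }
  induction K1 as [|k IH].
  - simpl Nat.add. rewrite (ER K2) by lia. f_equal. simpl; ring.
  - replace (S k + K2 + 1)%nat with (S (k + K2 + 1)) by lia.
    rewrite sum_n_Sm by lia. rewrite <- IH.
    rewrite (RInt_split f (- (2 * INR (S k) + 1) * T) (- (2 * INR k + 1) * T)) by exact Hc.
    rewrite Rplus_comm. apply (f_equal2 Rplus); [reflexivity|].
    rewrite (RInt_ext (F (S (k + K2 + 1))) (fun x => f (x + (- 2 * INR (S k) * T)))).
    + rewrite RInt_shift by exact Hc. rewrite S_INR; f_equal; ring.
    + intros x _. replace (x + - 2 * INR (S k) * T) with (x - 2 * INR (S k) * T) by ring.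
      rewrite <- HL by lia. f_equal; lia.
Qed.

Lemma t_fun_one f0 fT T K2 x : t_fun f0 fT T K2 1 x = 0.
Proof. reflexivity. Qed.

Lemma t_fun_right f0 fT T K2 k x :
  (1 <= k <= K2)%nat -> t_fun f0 fT T K2 (k + 1) x = t_right f0 fT T k x.
Proof.
  intros H. unfold t_fun.
  rewrite (proj2 (Nat.leb_gt (k + 1) 1)) by lia.
  rewrite (proj2 (Nat.leb_le (k + 1) (K2 + 1))) by lia.
  f_equal; lia.
Qed.

Lemma t_fun_left f0 fT T K2 k x :
  (1 <= k)%nat -> t_fun f0 fT T K2 (k + K2 + 1) x = t_left f0 fT T k x.
Proof.
  intros H. unfold t_fun.
  rewrite (proj2 (Nat.leb_gt (k + K2 + 1) 1)) by lia.
  rewrite (proj2 (Nat.leb_gt (k + K2 + 1) (K2 + 1))) by lia.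
  f_equal; lia.
Qed.

Lemma Ck_t_fun k f0 fT T K2 i :
  smooth f0 -> smooth fT -> Ck k (t_fun f0 fT T K2 i).
Proof.
  intros H0 HT.
  assert (D0 := smooth_Ck_Derive_n f0 k 1 H0 : Ck k (Derive f0)).
  assert (DT := smooth_Ck_Derive_n fT k 1 HT : Ck k (Derive fT)).
  unfold t_fun.
  destruct (Nat.leb i 1); [apply Ck_const|destruct (Nat.leb i (K2 + 1))].
  - set (j := (i - 1)%nat).
    apply (Ck_ext k (fun x =>
      1 * (1 * Derive f0 x
        + 2 * sum_n_m (fun n => Derive f0 (x + (2 * INR j - 2 * INR n) * T)) 0 (j - 1))
      + (-1) * (2 * sum_n_m (fun n => Derive fT (x + (2 * INR j - 2 * INR n - 1) * T)) 0 (j - 1)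
        + 1 * Derive f0 (x + 2 * INR j * T)))).
    { intros x; unfold t_right; ring. }
    repeat apply Ck_lin; auto using Ck_shift.
    + apply (Ck_sum k (fun n x => Derive f0 (x + (2 * INR j - 2 * INR n) * T))); auto using Ck_shift.
    + apply (Ck_sum k (fun n x => Derive fT (x + (2 * INR j - 2 * INR n - 1) * T))); auto using Ck_shift.
  - set (j := (i - (K2 + 1))%nat).
    apply (Ck_ext k (fun x =>
      1 * (1 * Derive f0 x
        + 2 * sum_n_m (fun n => Derive fT (x + (2 * INR n + 1 - 2 * INR j) * T)) 0 (j - 1))
      + (-1) * (2 * sum_n_m (fun n => Derive f0 (x + 2 * (INR n + 1 - INR j) * T)) 0 (j - 1)
        + 1 * Derive f0 (x + (- (2 * INR j * T)))))).
    { intros x; unfold t_left, Rminus; ring. }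
    repeat apply Ck_lin; auto using Ck_shift.
    + apply (Ck_sum k (fun n x => Derive fT (x + (2 * INR n + 1 - 2 * INR j) * T))); auto using Ck_shift.
    + apply (Ck_sum k (fun n x => Derive f0 (x + 2 * (INR n + 1 - INR j) * T))); auto using Ck_shift.
Qed.

Lemma Ck_t_mean k f0 fT T K1 K2 :
  smooth f0 -> smooth fT -> Ck k (t_mean f0 fT T K1 K2).
Proof.
  intros H0 HT.
  apply (Ck_ext k (fun x => / INR (K1 + K2 + 1) *
    sum_n_m (fun i => t_fun f0 fT T K2 i x) 1 (K1 + K2 + 1) + 0 * 0)).
  { intros x; unfold t_mean; ring. }
  apply (Ck_lin k _ _ _ (fun _ => 0)); [|apply Ck_const].
  apply (Ck_sum k (fun i x => t_fun f0 fT T K2 i x)).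
  intros i; apply Ck_t_fun; auto.
Qed.

Lemma Ck_jump k f0 fT T : smooth f0 -> smooth fT -> Ck k (jump f0 fT T).
Proof.
  intros H0 HT.
  assert (D0 := smooth_Ck_Derive_n f0 k 1 H0 : Ck k (Derive f0)).
  assert (DT := smooth_Ck_Derive_n fT k 1 HT : Ck k (Derive fT)).
  apply (Ck_ext k (fun x => 2 * Derive fT x +
    (-1) * (1 * Derive f0 (x + T) + 1 * Derive f0 (x + - T)))).
  { intros x; unfold jump, Rminus; ring. }
  repeat apply Ck_lin; auto using Ck_shift.
Qed.

(** Each cell contributes the product of the periodic weight with a translate of
    [v], that is with some [v - t_i]; the sum of these over [i] is
    [K (v - t_mean)]. *)
Lemma RInt_times_periodic (f0 fT : R -> R) (T : R) (K1 K2 : nat) (v p : R -> R) :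
  smooth f0 -> smooth fT -> Ck 1 v -> Ck 1 p ->
  (forall x, v (x + T) - v (x - T) = jump f0 fT T x) ->
  (forall x, p (x + T) - p (x - T) = 0) ->
  RInt (fun x => v x * p x) (- (2 * INR K1 + 1) * T) ((2 * INR K2 + 1) * T) =
  INR (K1 + K2 + 1) *
    RInt (fun x => (v x - t_mean f0 fT T K1 K2 x) * p x) (- T) T.
Proof.
  intros H0 HfT Hv Hp Hj Hper.
  assert (Hcv := Ck_continuous 1 v Hv); assert (Hcp := Ck_continuous 1 p Hp).
  assert (HK : INR (K1 + K2 + 1) <> 0) by (apply not_0_INR; lia).
  pose (F := fun (i : nat) (x : R) => (v x - t_fun f0 fT T K2 i x) * p x).
  assert (HF : forall i, Ck 0 (F i)).
  { intros i; split; [|exact I].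
    apply (continuous_product (fun x => v x - t_fun f0 fT T K2 i x) p); [|exact Hcp].
    intros x; apply (continuous_minus v); [apply Hcv|].
    apply (Ck_continuous 0), Ck_t_fun; auto. }
  rewrite (RInt_cells T (fun x => v x * p x) F K1 K2).
  - rewrite <- (Rplus_0_r (INR (K1 + K2 + 1) * _)).
    rewrite <- (Rmult_0_l (RInt (fun _ => 0) (- T) T)).
    rewrite <- RInt_lin.
    + apply RInt_ext; intros x _.
      assert (E : forall n, sum_n_m (fun i => F i x) 1 n =
        (INR n * v x - sum_n_m (fun i => t_fun f0 fT T K2 i x) 1 n) * p x).
      { induction n as [|n IH].
        - rewrite !sum_n_m_zero by lia. simpl. unfold zero; simpl; ring.
        - rewrite !sum_n_Sm, IH, S_INR by lia. unfold F, plus; simpl. ring. }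
      rewrite E. unfold t_mean.
      in_R.
      field; exact HK.
    + apply continuous_product; [|exact Hcp].
      intros x; apply (continuous_minus v); [apply Hcv|].
      apply (Ck_continuous 0), Ck_t_mean; auto.
    + intros x; apply continuous_const.
  - split; [|exact I]. apply continuous_product; auto.
  - exact HF.
  - intros x; unfold F; rewrite t_fun_one; ring.
  - intros k x Hk; unfold F. rewrite t_fun_right by exact Hk.
    destruct (periodic_shift T p Hper k x) as [-> _].
    destruct k as [|k]; [lia|]. now rewrite (shift_right f0 fT v T Hj).
  - intros k x Hk; unfold F. rewrite t_fun_left by exact Hk.
    destruct (periodic_shift T p Hper k x) as [_ ->].
    destruct k as [|k]; [lia|]. now rewrite (shift_left f0 fT v T Hj).
Qed.

(** * Inputs and d'Alembert's formula *)

(** The description of the inputs that the rest of the argument works with: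
    [dalembert_solution] and [solution_dalembert] show that these functions are
    exactly the inputs. *)
Definition admissible (f0 fT : R -> R) (T : R) (v : R -> R) : Prop :=
  Ck 1 v /\ RInt v (- T) T = const_A f0 fT T /\
  forall x, v (x + T) - v (x - T) = jump f0 fT T x.

Lemma is_derive_window (v : R -> R) (T x : R) :
  (forall x, continuous v x) ->
  is_derive (fun y => RInt v (y - T) (y + T)) x (v (x + T) - v (x - T)).
Proof.
  intros Hv.
  apply (is_derive_ext (fun y => RInt v 0 (y + T) - RInt v 0 (y + - T))).
  { intros y. pose proof (RInt_split v 0 (y - T) (y + T) Hv) as E.
    change (y + - T) with (y - T). rewrite E.
    in_R. ring. }
  apply (is_derive_minus (fun y => RInt v 0 (y + T)) (fun y => RInt v 0 (y + - T)));
    apply (is_derive_shift (fun y => RInt v 0 y) v); intros z; apply RInt_is_derive, Hv.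
Qed.

(** The right-hand side is the terminal condition for d'Alembert's formula; it is
    equivalent to its derivative together with its value at [x = 0]. *)
Lemma admissible_iff (f0 fT : R -> R) (T : R) (v : R -> R) :
  smooth f0 -> smooth fT -> Ck 1 v ->
  (admissible f0 fT T v <->
   forall x, RInt v (x - T) (x + T) = 2 * fT x - f0 (x + T) - f0 (x - T)).
Proof.
  intros H0 HfT Hv. assert (Hc := Ck_continuous 1 v Hv).
  destruct (Ck_Derive 0 f0 (smooth_Ck_Derive_n f0 1 0 H0)) as [D0 _].
  destruct (Ck_Derive 0 fT (smooth_Ck_Derive_n fT 1 0 HfT)) as [DT _].
  assert (HD : forall x, is_derive (fun x => 2 * fT x - f0 (x + T) - f0 (x - T)) x (jump f0 fT T x)).
  { intros x. unfold jump.
    apply (is_derive_minus (fun x => 2 * fT x - f0 (x + T)) (fun x => f0 (x + - T))).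
    - apply (is_derive_minus (fun x => 2 * fT x) (fun x => f0 (x + T))).
      + apply (is_derive_scal fT x 2), DT.
      + apply is_derive_shift, D0.
    - apply (is_derive_shift f0 (Derive f0)), D0. }
  split.
  - intros [_ [HA Hj]] x.
    assert (Hz : forall y, is_derive (fun y => RInt v (y - T) (y + T) -
      (2 * fT y - f0 (y + T) - f0 (y - T))) y 0).
    { intros y. evar_last.
      - apply (is_derive_minus (fun y => RInt v (y - T) (y + T))
          (fun y => 2 * fT y - f0 (y + T) - f0 (y - T))); [apply is_derive_window, Hc|apply HD].
      - rewrite Hj. apply (Rminus_diag (jump f0 fT T y)). }
    pose proof (zero_derivative_const _ Hz x 0) as E; simpl in E.
    rewrite Rplus_0_l, Rminus_0_l, HA in E. unfold const_A in E. lra.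
  - intros H; split; [exact Hv|split].
    + specialize (H 0). rewrite Rplus_0_l, Rminus_0_l in H. exact H.
    + intros x.
      apply (derive_agree (x - 1) (x + 1) (fun y => RInt v (y - T) (y + T))
        (fun x => 2 * fT x - f0 (x + T) - f0 (x - T)) x); [lra|lra|auto| |apply HD].
      apply is_derive_window, Hc.
Qed.

Definition continuous_strip (T : R) (w : R -> R -> R) : Prop :=
  continuous_on (strip T) (fun p : R * R => w (fst p) (snd p)).

Definition travelling (F G : R -> R) (t x : R) : R := F (x + t) + G (x - t).

Lemma is_derive_travelling_t (F dF G dG : R -> R) (t x : R) :
  (forall x, is_derive F x (dF x)) -> (forall x, is_derive G x (dG x)) ->
  is_derive (fun s => travelling F G s x) t (travelling dF (fun y => - dG y) t x).
Proof.
  intros HF HG. unfold travelling.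
  apply (is_derive_plus (fun s => F (x + s)) (fun s => G (x - s))); evar_last.
  - apply (is_derive_comp F (fun s => x + s)); [apply HF|auto_derive; [auto|reflexivity]].
  - apply (Rmult_1_l (dF (x + t))).
  - apply (is_derive_comp G (fun s => x - s)); [apply HG|auto_derive; [auto|reflexivity]].
  - unfold scal; simpl; unfold mult; simpl; ring.
Qed.

Lemma is_derive_travelling_x (F dF G dG : R -> R) (t x : R) :
  (forall x, is_derive F x (dF x)) -> (forall x, is_derive G x (dG x)) ->
  is_derive (fun y => travelling F G t y) x (travelling dF dG t x).
Proof.
  intros HF HG.
  apply (is_derive_plus (fun y => F (y + t)) (fun y => G (y + - t)));
    [apply (is_derive_shift F dF)|apply (is_derive_shift G dG)]; assumption.
Qed.

Lemma is_dt_travelling (T : R) (F dF G dG : R -> R) :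
  (forall x, is_derive F x (dF x)) -> (forall x, is_derive G x (dG x)) ->
  is_dt T (travelling F G) (travelling dF (fun y => - dG y)).
Proof.
  intros HF HG t x Ht.
  apply filterdiff_within_iff; [exact Ht|].
  apply is_derive_within, is_derive_travelling_t; auto.
Qed.

(** Both partial derivatives of a superposition of two travelling waves are again
    such superpositions, so the induction on [k] closes. *)
Lemma class_C_travelling (T : R) (k : nat) (F G : R -> R) :
  Ck k F -> Ck k G -> class_C T k (travelling F G).
Proof.
  revert F G; induction k as [|k IH]; intros F G HF HG.
  all: assert (Hc : continuous_strip T (travelling F G)).
  1, 3: apply continuous_on_forall; intros [t x] _; unfold travelling;
    apply (continuous_plus (fun p : R * R => F (snd p + fst p)) (fun p : R * R => G (snd p - fst p)));
    [apply (continuous_comp (fun p : R * R => snd p + fst p) F);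
     [apply (continuous_plus (fun p : R * R => snd p) (fun p : R * R => fst p));
      [apply continuous_snd|apply continuous_fst]
     |eapply Ck_continuous; exact HF]
    |apply (continuous_comp (fun p : R * R => snd p - fst p) G);
     [apply (continuous_minus (fun p : R * R => snd p) (fun p : R * R => fst p));
      [apply continuous_snd|apply continuous_fst]
     |eapply Ck_continuous; exact HG]].
  - split; [exact Hc|exact I].
  - split; [exact Hc|].
    destruct HF as [_ [dF [HF1 HF2]]]; destruct HG as [_ [dG [HG1 HG2]]].
    exists (travelling dF (fun y => - dG y)), (travelling dF dG).
    split; [|split; [|split]].
    + apply is_dt_travelling; auto.
    + intros t x _; apply is_derive_travelling_x; auto.
    + apply IH; [exact HF2|].
      apply (Ck_ext k (fun y => (-1) * dG y + 0 * 0)); [intros y; ring|].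
      apply (Ck_lin k _ _ dG (fun _ => 0)); [exact HG2|apply Ck_const].
    + apply IH; auto.
Qed.

Lemma Ck_primitive k (v : R -> R) : Ck k v -> Ck (S k) (fun x => RInt v 0 x).
Proof.
  intros H; apply Ck_derive with v; [|exact H].
  intros x; apply RInt_is_derive, (Ck_continuous k), H.
Qed.

(** d'Alembert's formula
    [(f0 (x + t) + f0 (x - t)) / 2 + (1 / 2) * (integral of v over [x - t, x + t])],
    split into its two travelling waves. *)
Definition dalembert (f0 v : R -> R) : R -> R -> R :=
  travelling (fun x => 1 / 2 * f0 x + 1 / 2 * RInt v 0 x)
             (fun x => 1 / 2 * f0 x + (- 1 / 2) * RInt v 0 x).

Lemma dalembert_terminal f0 v T x :
  (forall x, continuous v x) ->
  2 * dalembert f0 v T x = f0 (x + T) + f0 (x - T) + RInt v (x - T) (x + T).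
Proof.
  intros Hv. unfold dalembert, travelling.
  pose proof (RInt_split v 0 (x - T) (x + T) Hv). lra.
Qed.

Lemma dalembert_solution (f0 fT : R -> R) (T : R) (v : R -> R) :
  0 < T -> smooth f0 -> smooth fT -> admissible f0 fT T v ->
  TBVP_solution f0 fT T (dalembert f0 v) /\ has_input T (dalembert f0 v) v.
Proof.
  intros HT H0 HfT Ha. assert (Hv := proj1 Ha). assert (Hc := Ck_continuous 1 v Hv).
  set (F := fun x => 1 / 2 * f0 x + 1 / 2 * RInt v 0 x).
  set (G := fun x => 1 / 2 * f0 x + (- 1 / 2) * RInt v 0 x).
  assert (CF : Ck 2 F) by (apply Ck_lin; [apply (smooth_Ck_Derive_n f0 2 0 H0)|apply Ck_primitive, Hv]).
  assert (CG : Ck 2 G) by (apply Ck_lin; [apply (smooth_Ck_Derive_n f0 2 0 H0)|apply Ck_primitive, Hv]).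
  change (dalembert f0 v) with (travelling F G).
  split; [split; [|split; [|split]]|].
  - apply class_C_travelling; auto.
  - destruct CF as [_ [dF [HF [_ [d2F [HdF _]]]]]].
    destruct CG as [_ [dG [HG [_ [d2G [HdG _]]]]]].
    assert (HdG' : forall x, is_derive (fun y => - dG y) x (- d2G x)).
    { intros x; apply (is_derive_opp dG), HdG. }
    exists (travelling dF (fun y => - dG y)), (travelling d2F (fun y => - - d2G y)),
      (travelling dF dG), (travelling d2F d2G).
    split; [|split; [|split; [|split]]].
    + apply is_dt_travelling; auto.
    + apply is_dt_travelling; auto.
    + intros t x _; apply is_derive_travelling_x; auto.
    + intros t x _; apply is_derive_travelling_x; auto.
    + intros t x _; unfold travelling; ring.
  - intros x. unfold travelling, F, G. rewrite Rplus_0_r, Rminus_0_r. field.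
  - intros x. pose proof (dalembert_terminal f0 v T x Hc) as E.
    rewrite (proj1 (admissible_iff f0 fT T v H0 HfT Hv) Ha x) in E.
    change (travelling F G) with (dalembert f0 v). lra.
  - intros x. apply filterdiff_within_iff; [lra|].
    apply is_derive_within.
    destruct (Ck_Derive 0 f0 (smooth_Ck_Derive_n f0 1 0 H0)) as [D0 _].
    evar_last.
    + apply (is_derive_travelling_t F (fun x => 1 / 2 * Derive f0 x + 1 / 2 * v x)
        G (fun x => 1 / 2 * Derive f0 x + (- 1 / 2) * v x));
        intros y; apply is_derive_lin; auto; intros z; apply RInt_is_derive; auto.
    + unfold travelling. rewrite Rplus_0_r, Rminus_0_r.
      in_R. field.
Qed.

(** * Solutions are given by d'Alembert's formula *)

Lemma continuous_on_along (T : R) (w : R -> R -> R) (F : (R -> Prop) -> Prop)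
    (gt gx : R -> R) (t0 x0 : R) :
  Filter F ->
  continuous_strip T w -> 0 <= t0 <= T ->
  F (fun s => 0 <= gt s <= T) ->
  filterlim gt F (locally t0) -> filterlim gx F (locally x0) ->
  filterlim (fun s => w (gt s) (gx s)) F (locally (w t0 x0)).
Proof.
  intros FF Hw Ht HF Hgt Hgx.
  apply (filterlim_comp R (R * R) R (fun s => (gt s, gx s)) (fun p => w (fst p) (snd p)) F
    (within (strip T) (locally (t0, x0)))).
  - intros P [d Hd].
    assert (L1 : F (fun s => ball t0 d (gt s))) by (apply Hgt; exists d; auto).
    assert (L2 : F (fun s => ball x0 d (gx s))) by (apply Hgx; exists d; auto).
    unfold filtermap.
    apply (filter_imp (fun s => (ball t0 d (gt s) /\ ball x0 d (gx s)) /\ 0 <= gt s <= T)).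
    + intros s [[B1 B2] B3]. apply (Hd (gt s, gx s)); [split; assumption|exact B3].
    + apply filter_and; [apply filter_and|]; assumption.
  - apply (Hw (t0, x0)), Ht.
Qed.

Lemma continuous_on_interior (T : R) (w : R -> R -> R) (t x : R) :
  continuous_strip T w -> 0 < t < T ->
  continuous (fun p : R * R => w (fst p) (snd p)) (t, x).
Proof.
  intros Hw Ht.
  apply (continuous_continuous_on (strip T)); [|exact Hw].
  assert (Hp : 0 < Rmin t (T - t)) by (apply Rmin_glb_lt; lra).
  exists (mkposreal _ Hp). intros [s y] [Hs _].
  assert (Hs' : Rabs (s - t) < Rmin t (T - t)) by exact Hs.
  pose proof (Rmin_l t (T - t)); pose proof (Rmin_r t (T - t)).
  apply Rabs_def2 in Hs'. unfold strip; simpl; lra.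
Qed.

Lemma filterlim_within (D : R -> Prop) (f : R -> R) (t : R) :
  continuous f t -> filterlim f (within D (locally t)) (locally (f t)).
Proof.
  intros H P HP. unfold filtermap, within.
  apply (filter_imp (fun s => P (f s))); [auto|exact (H P HP)].
Qed.

Lemma filterlim_minus_scal (F : (R -> Prop) -> Prop) (f g : R -> R) (a b k : R) :
  Filter F -> filterlim f F (locally a) -> filterlim g F (locally b) ->
  filterlim (fun s => f s - k * g s) F (locally (a - k * b)).
Proof.
  intros FF Hf Hg.
  apply (filterlim_comp_2 f (fun s => - (k * g s)) Rplus Hf (H := locally (- (k * b)))).
  - apply (filterlim_comp R R R g (fun y => - (k * y)) F (locally b)); [exact Hg|].
    apply (ex_derive_continuous (fun y => - (k * y))). auto_derive; auto.
  - apply (filterlim_plus a (- (k * b))).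
Qed.

(** Composing with the projection onto [[0, T]] turns continuity relative to the
    interval into continuity on the line, as the mean value theorem wants. *)
Lemma constant_within (T : R) (p : R -> R) :
  (forall t, 0 < t < T -> is_derive p t 0) ->
  (forall t, 0 <= t <= T ->
    filterlim p (within (fun s => 0 <= s <= T) (locally t)) (locally (p t))) ->
  forall t, 0 <= t <= T -> p t = p 0.
Proof.
  intros Hd Hc t Ht.
  pose (clamp := fun s => Rmax (Rmin s T) 0).
  assert (Hin : forall s, 0 <= clamp s <= T).
  { intros s. unfold clamp, Rmax, Rmin.
    destruct (Rle_dec s T); destruct (Rle_dec _ 0); lra. }
  assert (Hid : forall s, 0 <= s <= T -> clamp s = s).
  { intros s Hs. unfold clamp. rewrite Rmin_left, Rmax_left; lra. }
  assert (Hcc : forall s, continuous clamp s).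
  { intros s. apply (continuous_comp (fun s => Rmin s T) (fun s => Rmax s 0));
      [apply continuous_Rmin|apply continuous_Rmax]. }
  assert (Hqc : forall s, continuous (fun s => p (clamp s)) s).
  { intros s. apply (filterlim_comp R R R clamp p (locally s)
      (within (fun s => 0 <= s <= T) (locally (clamp s)))); [|apply Hc, Hin].
    intros P HP. unfold filtermap. apply (filter_imp (fun y => (0 <= clamp y <= T) -> P (clamp y))).
    - intros y Hy; apply Hy, Hin.
    - exact (Hcc s _ HP). }
  destruct (MVT_gen (fun s => p (clamp s)) 0 t (fun _ => 0)) as [c [_ E]].
  - intros s Hs. rewrite Rmin_left, Rmax_right in Hs by lra.
    apply (is_derive_ext_loc p); [|apply Hd; lra].
    apply (locally_interval _ s 0 T); simpl; [lra|lra|].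
    intros y Hy1 Hy2. now rewrite Hid by lra.
  - intros s _. apply continuity_pt_filterlim, Hqc.
  - simpl in E. rewrite !Hid in E by lra. lra.
Qed.

Lemma is_dt_within T u ut t x :
  is_dt T u ut -> 0 <= t <= T -> derive_within 0 T (fun s => u s x) t (ut t x).
Proof. intros H Ht. apply filterdiff_within_iff; auto. Qed.

Lemma is_dt_interior T u ut t x :
  is_dt T u ut -> 0 < t < T -> is_derive (fun s => u s x) t (ut t x).
Proof.
  intros H Ht. apply (derive_within_interior 0 T); [exact Ht|].
  apply (is_dt_within T u ut t x H); lra.
Qed.

Lemma is_dt_unique T u w ut wt :
  0 < T -> same_on_strip T u w -> is_dt T u ut -> is_dt T w wt -> same_on_strip T ut wt.
Proof.
  intros HT Huw Hu Hw t x Ht.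
  apply (derive_within_unique 0 T (fun s => u s x) (fun s => w s x) t); auto using is_dt_within.
Qed.

Lemma is_dx_unique T u w ux wx :
  same_on_strip T u w -> is_dx T u ux -> is_dx T w wx -> same_on_strip T ux wx.
Proof.
  intros Huw Hu Hw t x Ht.
  apply (derive_agree (x - 1) (x + 1) (u t) (w t) x); [lra|lra| | |].
  - intros y _; apply Huw, Ht.
  - apply Hu, Ht.
  - apply Hw, Ht.
Qed.

(** Schwarz's theorem; the strict inequalities on [t] leave room for a
    two-dimensional neighbourhood inside the strip. *)
Lemma mixed_derivatives (T : R) (u ut ux utx uxt : R -> R -> R) (t x : R) :
  0 < t < T ->
  is_dt T u ut -> is_dx T u ux -> is_dx T ut utx -> is_dt T ux uxt ->
  continuous_strip T utx ->
  continuous_strip T uxt ->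
  uxt t x = utx t x.
Proof.
  intros Ht Hut Hux Hutx Huxt Ctx Cxt.
  assert (Hloc : forall s, 0 < s < T -> locally s (fun z => 0 < z < T)).
  { intros s Hs. apply (locally_interval _ s 0 T); simpl; auto; lra. }
  assert (Ht' : forall s y, 0 < s < T -> Derive (fun z => u z y) s = ut s y).
  { intros s y Hs. apply is_derive_unique, (is_dt_interior T u); auto. }
  assert (Hx' : forall s y, 0 < s < T -> Derive (fun z => u s z) y = ux s y).
  { intros s y Hs. apply is_derive_unique, Hux; lra. }
  assert (Hxt' : forall s y, 0 < s < T ->
    is_derive (fun z => Derive (fun r => u z r) y) s (uxt s y)).
  { intros s y Hs. apply (is_derive_ext_loc (fun z => ux z y)).
    - apply (filter_imp (fun z => 0 < z < T)); [|auto]. intros z Hz; symmetry; apply Hx', Hz.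
    - apply (is_dt_interior T ux); auto. }
  assert (Htx' : forall s y, 0 < s < T ->
    is_derive (fun z => Derive (fun r => u r z) s) y (utx s y)).
  { intros s y Hs. apply (is_derive_ext (fun z => ut s z)).
    - intros z; symmetry; apply Ht', Hs.
    - apply Hutx; lra. }
  assert (Hp : 0 < Rmin t (T - t)) by (apply Rmin_glb_lt; lra).
  assert (H2d : forall P : R -> R -> Prop,
    (forall s y, 0 < s < T -> P s y) -> locally_2d P t x).
  { intros P HP. exists (mkposreal _ Hp). intros s y Hs _. apply HP. simpl in Hs.
    pose proof (Rmin_l t (T - t)); pose proof (Rmin_r t (T - t)).
    apply Rabs_def2 in Hs. lra. }
  rewrite <- (is_derive_unique _ _ _ (Hxt' t x Ht)).
  rewrite <- (is_derive_unique _ _ _ (Htx' t x Ht)).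
  apply Schwarz.
  - apply H2d. intros s y Hs.
    split; [|split; [|split]]; eexists.
    + apply (is_dt_interior T u ut); auto.
    + apply Hux; lra.
    + apply Hxt', Hs.
    + apply Htx', Hs.
  - apply (continuity_2d_pt_ext_loc uxt).
    + apply H2d. intros s y Hs; symmetry; apply is_derive_unique, Hxt', Hs.
    + apply continuity_2d_pt_filterlim, (continuous_on_interior T uxt); auto.
  - apply (continuity_2d_pt_ext_loc utx).
    + apply H2d. intros s y Hs; symmetry; apply is_derive_unique, Htx', Hs.
    + apply continuity_2d_pt_filterlim, (continuous_on_interior T utx); auto.
Qed.

Lemma derive_along_line (T : R) (w wt wx : R -> R -> R) (c k t : R) :
  0 < t < T -> is_dt T w wt -> is_dx T w wx ->
  continuous_strip T wt ->
  is_derive (fun s => w s (c + k * s)) t (wt t (c + k * t) + k * wx t (c + k * t)).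
Proof.
  intros Ht Hwt Hwx Cwt.
  assert (Hf := is_derive_filterdiff w t (c + k * t) wt (wx t (c + k * t))).
  assert (Hk : is_derive (fun s => c + k * s) t k) by (auto_derive; [auto|ring]).
  apply (filterdiff_ext_lin (fun s => w s (c + k * s))
    (fun y => plus (scal y (wt t (c + k * t))) (scal (scal y k) (wx t (c + k * t))))).
  - apply (filterdiff_comp'_2 (fun s => s) (fun s => c + k * s) w t (fun y => y)
      (fun y => scal y k) (fun y z => plus (scal y (wt t (c + k * t))) (scal z (wx t (c + k * t))))).
    + apply filterdiff_id.
    + exact Hk.
    + apply Hf.
      * apply (filter_imp (fun q : R * R => 0 < fst q < T)).
        -- intros q Hq. apply (is_dt_interior T w wt); auto.
        -- assert (Hp : 0 < Rmin t (T - t)) by (apply Rmin_glb_lt; lra).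
           exists (mkposreal _ Hp). intros [s y] [Hs _].
           assert (Hs' : Rabs (s - t) < Rmin t (T - t)) by exact Hs.
           pose proof (Rmin_l t (T - t)); pose proof (Rmin_r t (T - t)).
           apply Rabs_def2 in Hs'. simpl; lra.
      * apply Hwx; lra.
      * apply (continuous_on_interior T wt); auto.
  - intros y. unfold plus, scal; simpl; unfold mult; simpl. ring.
Qed.

(** Along the characteristic [x = c + k t], [k = 1] or [k = - 1], the derivative of
    [u_t - k u_x] is [(u_tt - k^2 u_xx) + k (u_tx - u_xt)]. *)
Lemma characteristic (T : R) (u ut ux utt utx uxt uxx : R -> R -> R) (c k : R) :
  k * k = 1 ->
  is_dt T u ut -> is_dx T u ux -> is_dt T ut utt -> is_dx T ut utx ->
  is_dt T ux uxt -> is_dx T ux uxx ->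
  same_on_strip T utt uxx ->
  continuous_strip T ut ->
  continuous_strip T ux ->
  continuous_strip T utt ->
  continuous_strip T utx ->
  continuous_strip T uxt ->
  forall t, 0 <= t <= T ->
    ut t (c + k * t) - k * ux t (c + k * t) = ut 0 c - k * ux 0 c.
Proof.
  intros Hk Hut Hux Hutt Hutx Huxt Huxx Hw Ct Cx Ctt Ctx Cxt t Ht.
  assert (E := constant_within T (fun s => ut s (c + k * s) - k * ux s (c + k * s))).
  simpl in E. rewrite E; [|clear t Ht; intros t Ht|clear t Ht; intros t Ht|exact Ht].
  - replace (c + k * 0) with c by ring. reflexivity.
  - evar_last.
    + apply (is_derive_minus (fun s => ut s (c + k * s)) (fun s => k * ux s (c + k * s))).
      * apply (derive_along_line T ut utt utx c k t); auto.
      * apply (is_derive_scal (fun s => ux s (c + k * s)) t k).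
        apply (derive_along_line T ux uxt uxx c k t); auto.
    + rewrite (mixed_derivatives T u ut ux utx uxt) by auto.
      rewrite (Hw t) by lra.
      in_R.
      unfold minus, plus, opp; simpl.
      set (a := uxx t (c + k * t)). set (b := utx t (c + k * t)).
      replace (a + k * b + - (k * (b + k * a))) with (a * (1 - k * k)) by ring.
      rewrite Hk; ring.
  - assert (Hfl : forall w, continuous_strip T w ->
      filterlim (fun s => w s (c + k * s)) (within (fun s => 0 <= s <= T) (locally t))
        (locally (w t (c + k * t)))).
    { intros w Cw. apply (continuous_on_along T w _ (fun s => s) (fun s => c + k * s)); auto.
      - apply within_filter, locally_filter.
      - unfold within; apply filter_forall; auto.
      - intros P HP. unfold filtermap, within. apply (filter_imp P); auto.
      - apply (filterlim_within _ (fun s => c + k * s)).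
        apply (ex_derive_continuous (fun s => c + k * s)). auto_derive; auto. }
    apply filterlim_minus_scal; auto. apply within_filter, locally_filter.
Qed.

(** The two families of characteristics express [u_t] at any point through [v] and
    [f0'] at the two feet on the axis [t = 0]; integrating in [t] gives [u]. *)
Lemma solution_dalembert (f0 fT : R -> R) (T : R) (u : R -> R -> R) (v : R -> R) :
  0 < T -> smooth f0 -> smooth fT ->
  TBVP_solution f0 fT T u -> has_input T u v ->
  admissible f0 fT T v /\ same_on_strip T u (dalembert f0 v).
Proof.
  intros HT H0 HfT [Hclass [Hwave [Hu0 HuT]]] Hin.
  destruct Hclass as [Cu [ut [ux [Hut [Hux
    [[Ct [utt [utx [Hutt [Hutx [[Ctt _] [Ctx _]]]]]]]
     [Cx [uxt [uxx [Huxt [Huxx [[Cxt _] _]]]]]]]]]]]].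
  assert (Hw : same_on_strip T utt uxx).
  { destruct Hwave as [at_ [att [ax [axx [At [Att [Ax [Axx E]]]]]]]].
    assert (Et := is_dt_unique T u u ut at_ HT (fun _ _ _ => eq_refl) Hut At).
    assert (Ett := is_dt_unique T ut at_ utt att HT Et Hutt Att).
    assert (Ex := is_dx_unique T u u ux ax (fun _ _ _ => eq_refl) Hux Ax).
    assert (Exx := is_dx_unique T ux ax uxx axx Ex Huxx Axx).
    intros t x Ht. rewrite Ett, Exx by exact Ht. specialize (E t x Ht). lra. }
  assert (Hv : forall x, ut 0 x = v x).
  { intros x. apply (derive_within_unique 0 T (fun s => u s x) (fun s => u s x) 0); auto; try lra.
    - apply is_dt_within; [exact Hut|lra].
    - apply filterdiff_within_iff; [lra|apply Hin]. }
  assert (D0 := proj1 (Ck_Derive 0 f0 (smooth_Ck_Derive_n f0 1 0 H0))).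
  assert (Hx0 : forall x, ux 0 x = Derive f0 x).
  { intros x. apply (derive_agree (x - 1) (x + 1) (u 0) f0 x); [lra|lra|auto| |apply D0].
    apply Hux; lra. }
  assert (Hv1 : Ck 1 v).
  { apply (Ck_ext 1 (ut 0)); [exact Hv|].
    apply Ck_derive with (utx 0); [intros x; apply Hutx; lra|].
    split; [|exact I]. intros x.
    apply (continuous_on_along T utx _ (fun _ => 0) (fun y => y)); auto.
    - apply locally_filter.
    - lra.
    - apply filter_forall; intros _; lra.
    - apply filterlim_const.
    - apply filterlim_id. }
  assert (Hc := Ck_continuous 1 v Hv1).
  assert (Hform : forall t x, 0 <= t <= T -> ut t x =
    1 / 2 * (Derive f0 (x + t) + v (x + t)) + 1 / 2 * (v (x - t) - Derive f0 (x - t))).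
  { intros t x Ht.
    assert (Hchar := fun c k Hk => characteristic T u ut ux utt utx uxt uxx c k Hk
      Hut Hux Hutt Hutx Huxt Huxx Hw Ct Cx Ctt Ctx Cxt t Ht).
    assert (E1 := Hchar (x + t) (- 1) ltac:(ring)); assert (E2 := Hchar (x - t) 1 ltac:(ring)).
    replace (x + t + - 1 * t) with x in E1 by ring.
    replace (x - t + 1 * t) with x in E2 by ring.
    rewrite !Hv, !Hx0 in E1, E2. lra. }
  assert (Hsame : same_on_strip T u (dalembert f0 v)).
  { intros t x Ht.
    pose (D := dalembert f0 v).
    assert (HD : forall s, is_derive (fun s => D s x) s
      (travelling (fun y => 1 / 2 * Derive f0 y + 1 / 2 * v y)
        (fun y => - (1 / 2 * Derive f0 y + (- 1 / 2) * v y)) s x)).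
    { intros s. apply (is_derive_travelling_t _ (fun y => 1 / 2 * Derive f0 y + 1 / 2 * v y)
        _ (fun y => 1 / 2 * Derive f0 y + (- 1 / 2) * v y));
        intros y; apply is_derive_lin; auto; intros z; apply RInt_is_derive; auto. }
    assert (E := constant_within T (fun s => u s x - 1 * D s x)).
    assert (E' : u t x - 1 * D t x = u 0 x - 1 * D 0 x).
    { apply E; [clear t Ht; intros t Ht|clear t Ht; intros t Ht|exact Ht].
      - evar_last.
        + apply (is_derive_minus (fun s => u s x) (fun s => 1 * D s x)).
          * apply (is_dt_interior T u ut); auto.
          * apply (is_derive_scal (fun s => D s x) t 1), HD.
        + rewrite Hform by lra. unfold travelling, minus, plus, opp; simpl. field.
      - apply filterlim_minus_scal; [apply within_filter, locally_filter| |].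
        + apply (continuous_on_along T u _ (fun s => s) (fun _ => x)); auto.
          * apply within_filter, locally_filter.
          * unfold within; apply filter_forall; auto.
          * intros P HP. unfold filtermap, within. apply (filter_imp P); auto.
          * apply filterlim_const.
        + apply (filterlim_within _ (fun s => D s x)).
          apply (ex_derive_continuous (fun s => D s x)). eexists; apply HD. }
    assert (E0 : D 0 x = f0 x).
    { unfold D, dalembert, travelling. rewrite Rplus_0_r, Rminus_0_r. field. }
    rewrite E0, Hu0 in E'. fold D. lra. }
  split; [|exact Hsame].
  apply admissible_iff; auto. intros x.
  pose proof (dalembert_terminal f0 v T x Hc) as E.
  rewrite <- Hsame, HuT in E by lra. lra.
Qed.

(** * Minimal inputs *)

(** The directions in which an admissible function can be moved. *)
Definition periodic_mean_zero (T : R) (p : R -> R) : Prop :=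
  Ck 1 p /\ (forall x, p (x + T) - p (x - T) = 0) /\ RInt p (- T) T = 0.

Definition minimal_input (f0 fT : R -> R) (T : R) (K1 K2 : nat) (v : R -> R) : Prop :=
  admissible f0 fT T v /\
  forall w, admissible f0 fT T w -> input_norm T K1 K2 v <= input_norm T K1 K2 w.

Lemma admissible_perturb f0 fT T v p e :
  admissible f0 fT T v -> periodic_mean_zero T p ->
  admissible f0 fT T (fun x => 1 * v x + e * p x).
Proof.
  intros [Hv [HA Hj]] [Hp [Hper Hp0]].
  split; [apply Ck_lin; auto|split].
  - rewrite RInt_lin; [rewrite HA, Hp0; in_R; ring| |]; eapply Ck_continuous; eassumption.
  - intros x. specialize (Hper x). rewrite <- Hj.
    replace (p (x + T)) with (p (x - T)) by lra. ring.
Qed.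

Lemma admissible_difference f0 fT T v w :
  admissible f0 fT T v -> admissible f0 fT T w ->
  periodic_mean_zero T (fun x => 1 * w x + (-1) * v x).
Proof.
  intros [Hv [HA Hj]] [Hw [HA' Hj']].
  split; [apply Ck_lin; auto|split].
  - intros x. specialize (Hj x); specialize (Hj' x). lra.
  - rewrite RInt_lin; [rewrite HA, HA'; in_R; ring| |]; eapply Ck_continuous; eassumption.
Qed.

Lemma admissible_unique f0 fT T v w :
  0 < T -> admissible f0 fT T v -> admissible f0 fT T w ->
  (forall x, - T <= x <= T -> v x = w x) -> forall x, v x = w x.
Proof.
  intros HT Hv Hw E x.
  destruct (admissible_difference f0 fT T v w Hv Hw) as [_ [Hper _]].
  assert (H := periodic_zero T (fun x => 1 * w x + (-1) * v x) HT Hper).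
  simpl in H. enough (1 * w x + -1 * v x = 0) by lra.
  apply H. intros y Hy; rewrite E by exact Hy; ring.
Qed.

Lemma RInt_square_perturb (v p : R -> R) e a b :
  (forall x, continuous v x) -> (forall x, continuous p x) ->
  RInt (fun x => (1 * v x + e * p x) ^ 2) a b =
  RInt (fun x => v x ^ 2) a b + 2 * e * RInt (fun x => v x * p x) a b
    + e * e * RInt (fun x => p x * p x) a b.
Proof.
  intros Hv Hp.
  assert (Hvv := continuous_product v v Hv Hv).
  assert (Hvp := continuous_product v p Hv Hp).
  assert (Hpp := continuous_product p p Hp Hp).
  rewrite (RInt_ext (fun x => v x ^ 2) (fun x => v x * v x))
    by (intros x _; in_R; ring).
  transitivity (RInt (fun x => 1 * (1 * (v x * v x) + (2 * e) * (v x * p x)) + (e * e) * (p x * p x)) a b).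
  - apply RInt_ext; intros x _.
    in_R. ring.
  - rewrite RInt_lin, RInt_lin; auto.
    + in_R. ring.
    + apply continuous_lin; auto.
Qed.

Lemma input_norm_le (T : R) (K1 K2 : nat) (v w : R -> R) :
  0 < T -> (forall x, continuous v x) -> (forall x, continuous w x) ->
  (input_norm T K1 K2 v <= input_norm T K1 K2 w <->
   RInt (fun x => v x ^ 2) (- (2 * INR K1 + 1) * T) ((2 * INR K2 + 1) * T) <=
   RInt (fun x => w x ^ 2) (- (2 * INR K1 + 1) * T) ((2 * INR K2 + 1) * T)).
Proof.
  intros HT Hv Hw.
  assert (Hpos : forall f : R -> R, (forall x, continuous f x) ->
    0 <= RInt (fun x => f x ^ 2) (- (2 * INR K1 + 1) * T) ((2 * INR K2 + 1) * T)).
  { intros f Hf. apply RInt_ge_0.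
    - pose proof (pos_INR K1); pose proof (pos_INR K2); nra.
    - apply ex_RInt_cont. intros x. apply (continuous_ext (fun x => f x * f x)).
      + intros y; simpl; ring.
      + apply continuous_product; auto.
    - intros x _; apply pow2_ge_0. }
  unfold input_norm, L2norm; split.
  - apply sqrt_le_0; auto.
  - apply sqrt_le_1; auto.
Qed.

(** The first variation vanishes: along a line in a direction [p] the squared norm
    is a quadratic polynomial that is minimal at 0. *)
Lemma minimal_orthogonal f0 fT T K1 K2 v p :
  0 < T -> smooth f0 -> smooth fT ->
  minimal_input f0 fT T K1 K2 v -> periodic_mean_zero T p ->
  RInt (fun x => (v x - t_mean f0 fT T K1 K2 x) * p x) (- T) T = 0.
Proof.
  intros HT H0 HfT [Hv Hmin] Hp.
  assert (Hcv := Ck_continuous 1 v (proj1 Hv)).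
  assert (Hcp := Ck_continuous 1 p (proj1 Hp)).
  assert (HK : 0 < INR (K1 + K2 + 1)) by (apply lt_0_INR; lia).
  assert (E := RInt_times_periodic f0 fT T K1 K2 v p H0 HfT (proj1 Hv) (proj1 Hp)
    (proj2 (proj2 Hv)) (proj1 (proj2 Hp))).
  set (a := - (2 * INR K1 + 1) * T) in *. set (b := (2 * INR K2 + 1) * T) in *.
  set (B := RInt (fun x => v x * p x) a b) in *.
  set (Q := RInt (fun x => p x * p x) a b).
  assert (HQ : 0 <= Q).
  { apply RInt_ge_0.
    - unfold a, b. pose proof (pos_INR K1); pose proof (pos_INR K2); nra.
    - apply ex_RInt_cont, continuous_product; auto.
    - intros x _; nra. }
  assert (Hvar : forall e, 0 <= 2 * e * B + e * e * Q).
  { intros e.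
    assert (Hw := Hmin _ (admissible_perturb f0 fT T v p e Hv Hp)).
    apply input_norm_le in Hw; auto using continuous_lin.
    rewrite RInt_square_perturb in Hw by auto.
    fold a b B Q in Hw. lra. }
  (* The minimum of the polynomial is at - B / Q; the shift of the denominator
     keeps the choice effective when Q = 0. *)
  assert (HB : B = 0).
  { specialize (Hvar (- B / (Q + 1))).
    replace (2 * (- B / (Q + 1)) * B + - B / (Q + 1) * (- B / (Q + 1)) * Q)
      with (- ((B / (Q + 1)) ^ 2 * (Q + 2))) in Hvar by (field; lra).
    assert (H : B / (Q + 1) = 0) by nra.
    replace B with (B / (Q + 1) * (Q + 1)) by (field; lra). rewrite H; in_R; ring. }
  rewrite HB in E. symmetry in E. apply Rmult_integral in E. lra.
Qed.

(** The test direction is a bump times the deviation of [v - t_mean] from its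
    bump-weighted mean [c]. The bump vanishes to second order at the ends of the
    cell, so this product has a periodic extension of class C^1, and the
    orthogonality relation says that the weighted square of the deviation has
    integral 0. Hence [v - t_mean] is constant on the cell, and the prescribed
    integral of [v] gives the value of the constant. *)
Lemma minimal_eq_v_star f0 fT T K1 K2 v :
  0 < T -> smooth f0 -> smooth fT -> minimal_input f0 fT T K1 K2 v ->
  forall x, - T <= x <= T -> v x = v_star f0 fT T K1 K2 x.
Proof.
  intros HT H0 HfT Hmin.
  assert (Hv := proj1 (proj1 Hmin)).
  assert (Hm := Ck_t_mean 1 f0 fT T K1 K2 H0 HfT).
  set (m := t_mean f0 fT T K1 K2) in *.
  pose (h := fun x => 1 * v x + (-1) * m x).
  assert (Hh : Ck 1 h) by (apply Ck_lin; auto).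
  assert (Hch := Ck_continuous 1 h Hh).
  pose (bump := fun x => (T ^ 2 - x ^ 2) ^ 2).
  assert (Dbump : forall x, is_derive bump x (- 4 * x * (T ^ 2 - x ^ 2))).
  { intros x; unfold bump; auto_derive; [auto|ring]. }
  assert (Hb : Ck 1 bump).
  { apply Ck_derive with (1 := Dbump). split; [|exact I]. intros x.
    apply (ex_derive_continuous (fun x => - 4 * x * (T ^ 2 - x ^ 2))). auto_derive; auto. }
  assert (Hcb := Ck_continuous 1 bump Hb).
  assert (Hbx : forall x, - T < x < T -> 0 < bump x).
  { intros x Hx. assert (0 < T ^ 2 - x ^ 2) by nra. apply pow_lt; assumption. }
  assert (Hbpos : 0 < RInt bump (- T) T) by (apply RInt_gt_0; [lra|exact Hbx|auto]).
  pose (c := RInt (fun x => bump x * h x) (- T) T / RInt bump (- T) T).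
  pose (dev := fun x => 1 * h x + (- c) * 1).
  assert (Hd : Ck 1 dev) by (apply (Ck_lin 1 _ _ h (fun _ => 1)); [auto|apply Ck_const]).
  pose (q := fun x => bump x * dev x).
  assert (Hq : Ck 1 q) by (apply Ck_mult1; auto).
  assert (Hcq := Ck_continuous 1 q Hq).
  assert (Dq : forall x, T ^ 2 - x ^ 2 = 0 -> q x = 0 /\ Derive q x = 0).
  { intros x Hx. split.
    - unfold q, bump. rewrite Hx; ring.
    - apply is_derive_unique. evar_last.
      + apply (is_derive_mult bump dev); [apply Dbump|apply (proj1 (Ck_Derive 0 dev Hd))|].
        intros; apply Rmult_comm.
      + change (- 4 * x * (T ^ 2 - x ^ 2) * dev x + bump x * Derive dev x = 0).
        unfold bump. rewrite Hx. ring. }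
  assert (Hq0 : RInt q (- T) T = 0).
  { transitivity (RInt (fun x => 1 * (bump x * h x) + (- c) * bump x) (- T) T).
    - apply RInt_ext; intros x _. unfold q, dev.
      in_R. ring.
    - rewrite RInt_lin; auto using continuous_product.
      unfold c. in_R. field; lra. }
  destruct (Dq T ltac:(ring)) as [qT dqT]; destruct (Dq (- T) ltac:(ring)) as [qT' dqT'].
  destruct (C1_extension T q (fun _ => 0)) as [p [Hp [Hpq Hper]]];
    [exact HT|exact Hq|apply Ck_const|lra|rewrite Derive_const; lra|].
  assert (Hext : forall f : R -> R, RInt (fun x => f x * p x) (- T) T = RInt (fun x => f x * q x) (- T) T).
  { intros f. apply RInt_ext; intros x Hx. rewrite Rmin_left, Rmax_right in Hx by lra.
    now rewrite Hpq by lra. }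
  assert (Hp0 : periodic_mean_zero T p).
  { split; [exact Hp|split; [exact Hper|]]. rewrite <- Hq0.
    apply RInt_ext; intros x Hx. rewrite Rmin_left, Rmax_right in Hx by lra. apply Hpq; lra. }
  assert (Horth := minimal_orthogonal f0 fT T K1 K2 v p HT H0 HfT Hmin Hp0).
  rewrite (Hext (fun x => v x - t_mean f0 fT T K1 K2 x)) in Horth. fold m in Horth.
  assert (Hsq : RInt (fun x => bump x * (dev x * dev x)) (- T) T = 0).
  { transitivity (RInt (fun x => 1 * ((v x - m x) * q x) + (- c) * q x) (- T) T).
    - apply RInt_ext; intros x _. unfold q, dev, h.
      in_R. ring.
    - rewrite RInt_lin.
      + rewrite Horth, Hq0. in_R. ring.
      + apply continuous_product; [|exact Hcq].
        intros x; apply (continuous_ext h); [intros y; unfold h; in_R; ring|apply Hch].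
      + exact Hcq. }
  assert (Hcd := Ck_continuous 1 dev Hd).
  assert (Hdev : forall x, - T <= x <= T -> dev x = 0).
  { apply continuous_zero_closure; [lra|exact Hcd|].
    intros x Hx.
    assert (Z := RInt_nonneg_eq_0 (fun x => bump x * (dev x * dev x)) (- T) T
      (continuous_product _ _ Hcb (continuous_product _ _ Hcd Hcd))
      (fun x => Rmult_le_pos _ _ (pow2_ge_0 _) (Rle_0_sqr (dev x))) Hsq x Hx).
    destruct (Rmult_integral _ _ Z) as [Zb|Zd].
    - specialize (Hbx x Hx). lra.
    - destruct (Rmult_integral _ _ Zd); assumption. }
  assert (Hvm : forall x, - T <= x <= T -> v x = m x + c).
  { intros x Hx. specialize (Hdev x Hx). unfold dev, h in Hdev. lra. }
  assert (HA : const_A f0 fT T = RInt m (- T) T + c * (2 * T)).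
  { rewrite <- (proj1 (proj2 (proj1 Hmin))).
    transitivity (RInt (fun x => 1 * m x + c * 1) (- T) T).
    - apply RInt_ext; intros x Hx. rewrite Rmin_left, Rmax_right in Hx by lra.
      rewrite Hvm by lra. in_R. ring.
    - rewrite (RInt_lin 1 c m (fun _ => 1)).
      + rewrite RInt_const. unfold scal; simpl; unfold mult; simpl. ring.
      + apply (Ck_continuous 1), Hm.
      + intros x; apply continuous_const. }
  intros x Hx. rewrite Hvm by exact Hx.
  unfold v_star, const_A1. fold m. rewrite HA. field; lra.
Qed.

(** On the central cell [v - t_mean] is constant, hence [v] is orthogonal to the
    difference with any other admissible function, and Pythagoras applies. *)
Lemma v_star_minimal f0 fT T K1 K2 v :
  0 < T -> smooth f0 -> smooth fT -> admissible f0 fT T v ->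
  (forall x, - T <= x <= T -> v x = v_star f0 fT T K1 K2 x) ->
  minimal_input f0 fT T K1 K2 v.
Proof.
  intros HT H0 HfT Hv Hstar; split; [exact Hv|].
  intros w Hw.
  destruct (admissible_difference f0 fT T v w Hv Hw) as [Hp [Hper Hp0]].
  set (p := fun x => 1 * w x + -1 * v x) in *.
  assert (Hcv := Ck_continuous 1 v (proj1 Hv)); assert (Hcw := Ck_continuous 1 w (proj1 Hw)).
  assert (Hcp := Ck_continuous 1 p Hp).
  apply input_norm_le; auto.
  rewrite (RInt_ext (fun x => w x ^ 2) (fun x => (1 * v x + 1 * p x) ^ 2)).
  2: { intros x _. f_equal. unfold p. in_R. ring. }
  rewrite RInt_square_perturb by auto.
  rewrite (RInt_times_periodic f0 fT T K1 K2 v p H0 HfT (proj1 Hv) Hp (proj2 (proj2 Hv)) Hper).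
  assert (E : RInt (fun x => (v x - t_mean f0 fT T K1 K2 x) * p x) (- T) T = 0).
  { pose (k := const_A1 f0 fT T K1 K2 / (2 * T)).
    transitivity (RInt (fun x => k * p x + 0 * p x) (- T) T).
    - apply RInt_ext; intros x Hx. rewrite Rmin_left, Rmax_right in Hx by lra.
      rewrite Hstar by lra. unfold v_star; fold k.
      in_R. ring.
    - rewrite RInt_lin, Hp0 by auto. in_R. ring. }
  rewrite E.
  assert (0 <= RInt (fun x => p x * p x) (- (2 * INR K1 + 1) * T) ((2 * INR K2 + 1) * T)).
  { apply RInt_ge_0.
    - pose proof (pos_INR K1); pose proof (pos_INR K2); nra.
    - apply ex_RInt_cont, continuous_product; auto.
    - intros x _; nra. }
  lra.
Qed.

Lemma Ck_v_star k f0 fT T K1 K2 :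
  smooth f0 -> smooth fT -> Ck k (v_star f0 fT T K1 K2).
Proof.
  intros H0 HfT.
  apply (Ck_ext k (fun x => 1 * t_mean f0 fT T K1 K2 x + 1 * (const_A1 f0 fT T K1 K2 / (2 * T)))).
  { intros x; unfold v_star; ring. }
  apply (Ck_lin k _ _ _ (fun _ => const_A1 f0 fT T K1 K2 / (2 * T))); [apply Ck_t_mean; auto|apply Ck_const].
Qed.

Lemma RInt_v_star f0 fT T K1 K2 :
  0 < T -> smooth f0 -> smooth fT ->
  RInt (v_star f0 fT T K1 K2) (- T) T = const_A f0 fT T.
Proof.
  intros HT H0 HfT.
  transitivity (RInt (fun x => 1 * t_mean f0 fT T K1 K2 x + const_A1 f0 fT T K1 K2 / (2 * T) * 1) (- T) T).
  - apply RInt_ext; intros x _. unfold v_star.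
    in_R. ring.
  - rewrite (RInt_lin _ _ _ (fun _ => 1)).
    + rewrite RInt_const. unfold const_A1, scal; simpl; unfold mult; simpl.
      in_R. field; lra.
    + apply (Ck_continuous 0), Ck_t_mean; auto.
    + intros x; apply continuous_const.
Qed.

Lemma jump_0 f0 fT T : jump f0 fT T 0 = const_c1 f0 fT T.
Proof. unfold jump, const_c1. now rewrite Rplus_0_l, Rminus_0_l. Qed.

Lemma Derive_jump_0 f0 fT T :
  smooth f0 -> smooth fT -> Derive (jump f0 fT T) 0 = const_c2 f0 fT T.
Proof.
  intros H0 HfT.
  assert (D0 := proj1 (Ck_Derive 0 _ (smooth_Ck_Derive_n f0 1 1 H0))).
  assert (DT := proj1 (Ck_Derive 0 _ (smooth_Ck_Derive_n fT 1 1 HfT))).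
  apply is_derive_unique. unfold jump. evar_last.
  - apply (is_derive_minus (fun x => 2 * Derive fT x - Derive f0 (x + T)) (fun x => Derive f0 (x + - T))).
    + apply (is_derive_minus (fun x => 2 * Derive fT x) (fun x => Derive f0 (x + T))).
      * apply (is_derive_scal (Derive fT) 0 2), DT.
      * apply is_derive_shift, D0.
    + apply (is_derive_shift (Derive f0) (Derive (Derive f0))), D0.
  - unfold const_c2. rewrite !Rplus_0_l. reflexivity.
Qed.

(** The two conditions say that [v_star] can be continued across the ends of the
    central cell, by the difference equation, as a function of class C^1. *)
Lemma v_star_compatible f0 fT T K1 K2 :
  0 < T -> smooth f0 -> smooth fT ->
  ((exists v, admissible f0 fT T v /\
      forall x, - T <= x <= T -> v x = v_star f0 fT T K1 K2 x) <->
   (v_star f0 fT T K1 K2 T = v_star f0 fT T K1 K2 (- T) + const_c1 f0 fT T /\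
    Derive (v_star f0 fT T K1 K2) T =
      Derive (v_star f0 fT T K1 K2) (- T) + const_c2 f0 fT T)).
Proof.
  intros HT H0 HfT.
  assert (Hs := Ck_v_star 1 f0 fT T K1 K2 H0 HfT).
  assert (Hj := Ck_jump 1 f0 fT T H0 HfT).
  assert (Ds := proj1 (Ck_Derive 0 _ Hs)); assert (Dj := proj1 (Ck_Derive 0 _ Hj)).
  rewrite <- Derive_jump_0, <- jump_0 by assumption.
  split.
  - intros [v [[Hv [_ Hvj]] E]].
    assert (Dv := proj1 (Ck_Derive 0 _ Hv)).
    assert (DE : forall x, - T <= x <= T -> Derive v x = Derive (v_star f0 fT T K1 K2) x).
    { intros x Hx. apply (derive_agree (- T) T v (v_star f0 fT T K1 K2) x); auto; lra. }
    rewrite <- !E, <- !DE by lra. split.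
    + rewrite <- Hvj, Rplus_0_l, Rminus_0_l. ring.
    + assert (Ej : Derive v T - Derive v (- T) = Derive (jump f0 fT T) 0); [|lra].
      apply (derive_agree (-1) 1 (fun y => v (y + T) - v (y + - T)) (jump f0 fT T) 0);
        [lra|lra|intros; apply Hvj| |apply Dj].
      apply (is_derive_minus (fun y => v (y + T)) (fun y => v (y + - T)));
        [replace (Derive v T) with (Derive v (0 + T)) by (now rewrite Rplus_0_l)
        |replace (Derive v (- T)) with (Derive v (0 + - T)) by (now rewrite Rplus_0_l)];
        apply (is_derive_shift v (Derive v)), Dv.
  - intros [E1 E2].
    destruct (C1_extension T _ _ HT Hs Hj E1 E2) as [v [Hv [Hvs Hvj]]].
    exists v; split; [|exact Hvs]. split; [exact Hv|split; [|exact Hvj]].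
    rewrite <- (RInt_v_star f0 fT T K1 K2 HT H0 HfT).
    apply RInt_ext; intros x Hx. rewrite Rmin_left, Rmax_right in Hx by lra. apply Hvs; lra.
Qed.

Lemma minimum_input_solution_iff f0 fT T K1 K2 u :
  0 < T -> smooth f0 -> smooth fT ->
  (minimum_input_solution f0 fT T K1 K2 u <->
   exists v, TBVP_solution f0 fT T u /\ has_input T u v /\ admissible f0 fT T v /\
     forall x, - T <= x <= T -> v x = v_star f0 fT T K1 K2 x).
Proof.
  intros HT H0 HfT; split.
  - intros [Hu [v [Hin Hmin]]].
    assert (Ha := proj1 (solution_dalembert f0 fT T u v HT H0 HfT Hu Hin)).
    exists v; repeat (split; [assumption|]).
    apply minimal_eq_v_star; auto. split; [exact Ha|].
    intros w Hw. apply Hmin. exists (dalembert f0 w). apply dalembert_solution; auto.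
  - intros [v [Hu [Hin [Ha E]]]].
    split; [exact Hu|exists v; split; [exact Hin|]].
    intros w [u' [Hu' Hin']].
    apply (v_star_minimal f0 fT T K1 K2 v HT H0 HfT Ha E).
    exact (proj1 (solution_dalembert f0 fT T u' w HT H0 HfT Hu' Hin')).
Qed.

Lemma dalembert_ext f0 v w :
  (forall x, v x = w x) -> forall t x, dalembert f0 v t x = dalembert f0 w t x.
Proof.
  intros E t x. unfold dalembert, travelling.
  now rewrite !(RInt_ext v w) by (intros; apply E).
Qed.

(** * Existence and uniqueness of the minimum-input solution *)

Theorem mainTheorem7 (f0 fT : R -> R) (T : R) (K1 K2 : nat)
    (hT : 0 < T) (hf0 : smooth f0) (hfT : smooth fT)
    (hK1 : (1 <= K1)%nat) (hK2 : (1 <= K2)%nat) :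
  ((exists u : R -> R -> R, minimum_input_solution f0 fT T K1 K2 u) <->
   (v_star f0 fT T K1 K2 T = v_star f0 fT T K1 K2 (- T) + const_c1 f0 fT T /\
    Derive (v_star f0 fT T K1 K2) T =
      Derive (v_star f0 fT T K1 K2) (- T) + const_c2 f0 fT T)) /\
  (forall u : R -> R -> R, minimum_input_solution f0 fT T K1 K2 u ->
    (forall w : R -> R -> R, minimum_input_solution f0 fT T K1 K2 w ->
       same_on_strip T w u) /\
    (exists v : R -> R, has_input T u v /\
       forall x : R, - T <= x <= T -> v x = v_star f0 fT T K1 K2 x) /\
    (forall (w : R -> R -> R) (v : R -> R),
       TBVP_solution f0 fT T w -> has_input T w v ->
       (forall x : R, - T <= x <= T -> v x = v_star f0 fT T K1 K2 x) ->
       same_on_strip T w u)).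
Proof.
  split.
  - rewrite <- v_star_compatible by assumption. split.
    + intros [u Hu]. apply minimum_input_solution_iff in Hu; auto.
      destruct Hu as [v [_ [_ H]]]. exists v; exact H.
    + intros [v [Ha E]]. exists (dalembert f0 v).
      apply minimum_input_solution_iff; auto.
      destruct (dalembert_solution f0 fT T v hT hf0 hfT Ha) as [Hu Hin].
      exists v; auto.
  - intros u Hu. apply minimum_input_solution_iff in Hu; auto.
    destruct Hu as [v [Hu [Hin [Ha E]]]].
    assert (Huniq : forall w v', TBVP_solution f0 fT T w -> has_input T w v' ->
      (forall x, - T <= x <= T -> v' x = v_star f0 fT T K1 K2 x) -> same_on_strip T w u).
    { intros w v' Hw Hin' E' t x Ht.
      destruct (solution_dalembert f0 fT T u v hT hf0 hfT Hu Hin) as [_ Eu].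
      destruct (solution_dalembert f0 fT T w v' hT hf0 hfT Hw Hin') as [Ha' Ew].
      rewrite Eu, Ew by exact Ht. apply dalembert_ext.
      apply (admissible_unique f0 fT T); auto.
      intros y Hy. now rewrite E, E'. }
    split; [|split; [|exact Huniq]].
    + intros w Hw. apply minimum_input_solution_iff in Hw; auto.
      destruct Hw as [v' [Hw [Hin' [_ E']]]]. exact (Huniq w v' Hw Hin' E').
    + exists v; auto.
Qed.
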